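(* Let $\rho>0$, let $\phi_1,\dots,\phi_m\in L^2(I)$ be linearly independent functions $I\to\mathbb{R}$, write $f_a:=\sum_{j=1}^m a_j\phi_j$ for $a\in\mathbb{R}^m$, and let $\Sigma$ be the inverse of the $m\times m$ matrix $\Sigma^{-1}$ with entries $[\Sigma^{-1}]_{j,l}=\int_I\phi_j(t)\phi_l(t)\,dt$. For $a\in\mathbb{R}^m$ let $\tilde a=M(a):=a+\frac{1}{\sqrt{2\rho}}\Sigma^{1/2}Z$, where $Z\sim\mathcal{N}(0,I_{m\times m})$. Then $M$ is $\rho$-CGP (with respect to the metric $(a,a')\mapsto\mathrm{dist}_2(f_a,f_{a'})$), and for every $a\in\mathbb{R}^m$: 1. $\mathbb{E}[\mathrm{dist}_2(f_{\tilde a},f_a)]=\sqrt{2}\,\frac{\Gamma(m/2+1/2)}{\Gamma(m/2)\sqrt{2\rho}}\le\frac{\sqrt{m}}{\sqrt{2\rho}}$; 2. for every $\beta\in(0,1)$, with probability at least $1-\beta$, $\mathrm{dist}_2(f_{\tilde a},f_a)\le\frac{\eta(\beta;m,2)}{\sqrt{2\rho}}$, where $\eta(\beta;m,2):=\sqrt{m+2\sqrt{m\ln(1/\beta)}+2\ln(1/\beta)}$.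
   Context: $I=I_1\times\cdots\times I_d$ with each $I_i\subseteq\mathbb{R}$ (measurable); $L^2(I)$ is the space of square-integrable functions on $I$ (functions equal almost everywhere are identified), and $\mathrm{dist}_2(f,g):=\left(\int_I (f(t)-g(t))^2\,dt\right)^{1/2}$. $\Sigma^{1/2}$ is the symmetric positive definite square root of $\Sigma$. $\mathcal{N}(0,I_{m\times m})$ is the standard Gaussian distribution on $\mathbb{R}^m$, and $\Gamma$ is the gamma function. For distributions $\mathcal{P},\mathcal{Q}$ with densities $p,q$ and $\alpha>1$, the Rényi divergence of order $\alpha$ is $D_\alpha(\mathcal{P}\|\mathcal{Q}):=\frac{1}{\alpha-1}\log\left(\int p(y)^\alpha q(y)^{1-\alpha}\,dy\right)$. A randomized mechanism $M:U\to V$ on a metric space $(U,\mathrm{dist})$, with $\mathcal{M}(x)$ denoting the distribution of $M(x)$, satisfies $\rho$-CGP (concentrated geo-privacy) if for all $x,x'\in U$ and all $\alpha>1$, $D_\alpha(\mathcal{M}(x)\|\mathcal{M}(x'))\le\alpha\rho\,\mathrm{dist}(x,x')^2$. *)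

(* Defs.v *)
From HB Require Import structures.
From mathcomp Require Import all_boot all_order all_algebra.
From mathcomp Require Import all_classical all_reals all_analysis.
From mathcomp Require Import measurable_realfun.

Set Implicit Arguments.
Unset Strict Implicit.
Unset Printing Implicit Defensive.

Import Order.TTheory GRing.Theory Num.Theory.
Import numFieldNormedType.Exports.

Local Open Scope classical_set_scope.
Local Open Scope ring_scope.

Section tuple_measure.
Context d (T : measurableType d) (R : realType).

Definition tuple_cons n (x : T * n.-tuple T) : n.+1.-tuple T :=
  [tuple of x.1 :: x.2].

Lemma measurable_tuple_cons n : measurable_fun setT (@tuple_cons n).
Proof. exact: measurable_cons. Qed.

Definition tuple_uncons n (t : n.+1.-tuple T) : T * n.-tuple T :=
  (thead t, [tuple of behead t]).

Lemma measurable_tuple_uncons n : measurable_fun setT (@tuple_uncons n).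
Proof.
apply/measurable_fun_pairP; split => /=.
  exact: measurable_tnth.
exact: measurable_behead.
Qed.

Lemma tuple_consK n : cancel (@tuple_cons n) (@tuple_uncons n).
Proof.
move=> [x t]; rewrite /tuple_uncons theadE; congr pair; exact/val_inj.
Qed.

Section step.
Variables (mu : {sigma_finite_measure set T -> \bar R}) (n : nat).
Variable nu : {sigma_finite_measure set (n.-tuple T) -> \bar R}.

Let step := pushforward (mu \x nu)%E (@tuple_cons n).

Let step0 : step set0 = 0%E.
Proof. by have mf := @measurable_tuple_cons n; exact: measure0. Qed.

Let step_ge0 A : (0 <= step A)%E.
Proof. by have mf := @measurable_tuple_cons n; exact: measure_ge0. Qed.

Let step_additive : semi_sigma_additive step.
Proof.
by have mf := @measurable_tuple_cons n; exact: measure_semi_sigma_additive.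
Qed.

HB.instance Definition _ := isMeasure.Build _ _ _ step
  step0 step_ge0 step_additive.

Let step_sigma_finite : sigma_finite setT step.
Proof.
have /sigma_finiteP[F [TF ndF Foo]] := sigma_finiteT mu.
have /sigma_finiteP[G [TG ndG Goo]] := sigma_finiteT nu.
exists (fun k => @tuple_uncons n @^-1` (F k `*` G k)).
  rewrite -preimage_bigcup (_ : \bigcup_k _ = setT) ?preimage_setT//.
  apply/seteqP; split => // -[x t] _.
  have [i _ Fix] : (\bigcup_k F k) x by rewrite -TF.
  have [j _ Gjt] : (\bigcup_k G k) t by rewrite -TG.
  exists (maxn i j) => //; split => /=.
    by move: x Fix; exact/subsetPset/ndF/leq_maxl.
  by move: t Gjt; exact/subsetPset/ndG/leq_maxr.
move=> k; have [mF Fk] := Foo k; have [mG Gk] := Goo k; split.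
  rewrite -[X in measurable X]setTI; apply: measurable_tuple_uncons => //.
  exact: measurableX.
rewrite /step /pushforward -comp_preimage (_ : _ \o _ = id); last first.
  by apply/funext => x; exact: tuple_consK.
by rewrite product_measure1E// lte_mul_pinfty// ge0_fin_numE.
Qed.

HB.instance Definition _ := Measure_isSigmaFinite.Build _ _ _ step
  step_sigma_finite.

Definition tuple_measureS :
  {sigma_finite_measure set (n.+1.-tuple T) -> \bar R} := step.

End step.

(* The n-fold product measure mu \x ... \x mu on n.-tuple T. *)
Fixpoint tuple_measure (mu : {sigma_finite_measure set T -> \bar R}) n :
    {sigma_finite_measure set (n.-tuple T) -> \bar R} :=
  if n is n'.+1 return {sigma_finite_measure set (n.-tuple T) -> \bar R}
  then tuple_measureS mu (@tuple_measure mu n')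
  else \d_([tuple] : 0.-tuple T).

End tuple_measure.
Arguments tuple_measure {d T R} mu n.

(* The real line with the sigma-algebra of Lebesgue-measurable sets;
   measurableTypeR R carries the Borel sets only. *)
Definition lebesgueTypeR (R : realType) : Type :=
  caratheodory_type (wlength (@idfun R))^*%mu.
HB.instance Definition _ (R : realType) := Measurable.on (lebesgueTypeR R).

(* Lebesgue measure on R^d. Its domain is the product of the 1-dimensional
   Lebesgue sigma-algebras, which contains every box with Lebesgue-measurable
   sides; it is not completed, but every function that is measurable for the
   completion is a.e. equal to one measurable for the product. *)
Definition lebesgue_measure_Rd (R : realType) (d : nat) :
    {sigma_finite_measure set (d.-tuple (lebesgueTypeR R)) -> \bar R} :=
  tuple_measure (@completed_lebesgue_measure R) d.

(* Lebesgue measure on the Borel sets of R^m. *)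
Definition borel_measure_Rm (R : realType) (m : nat) :
    {sigma_finite_measure set (m.-tuple (measurableTypeR R)) -> \bar R} :=
  tuple_measure (@lebesgue_measure R) m.

Definition std_gaussian (R : realType) (m : nat) :
    {sigma_finite_measure set (m.-tuple (measurableTypeR R)) -> \bar R} :=
  tuple_measure (normal_prob (0 : R) 1) m.

Definition box (T : Type) (d : nat) (I : 'I_d -> set T) : set (d.-tuple T) :=
  [set t | forall i, I i (tnth t i)].

Section L2.
Context d (T : measurableType d) (R : realType).
Variables (mu : {measure set T -> \bar R}) (I : set T).

Definition square_integrable (f : T -> R) : Prop :=
  measurable_fun I f /\ (\int[mu]_(t in I) ((f t) ^+ 2)%:E < +oo)%E.

Definition dist2 (f g : T -> R) : R :=
  Num.sqrt (\int[mu]_(t in I) (f t - g t) ^+ 2).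

Variables (m : nat) (phi : 'I_m -> T -> R).

Definition lincomb (a : m.-tuple (measurableTypeR R)) (t : T) : R :=
  \sum_(j < m) tnth a j * phi j t.

(* Independence as elements of L^2(I), where 0 means a.e. 0 on I. *)
Definition lin_indep : Prop :=
  forall a : m.-tuple (measurableTypeR R),
    {ae mu, forall t, I t -> lincomb a t = 0} -> forall j, tnth a j = 0.

Definition gram_mx : 'M[R]_m :=
  \matrix_(j, l) \int[mu]_(t in I) (phi j t * phi l t).

End L2.

Definition posdef_mx (R : realType) (n : nat) (A : 'M[R]_n) : Prop :=
  A^T = A /\ forall v : 'cV[R]_n, v != 0 -> 0 < (v^T *m A *m v) 0 0.

(* The symmetric positive definite square root (0 if there is none). *)
Definition sqrt_mx (R : realType) (n : nat) (A : 'M[R]_n) : 'M[R]_n :=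
  xget 0 [set S : 'M[R]_n | posdef_mx S /\ S *m S = A].

Definition Gamma (R : realType) (s : R) : R :=
  \int[lebesgue_measure]_(t in `]0, +oo[) (t `^ (s - 1) * expR (- t)).

(* eta(beta; m, 2) *)
Definition eta2 (R : realType) (beta : R) (m : nat) : R :=
  Num.sqrt (m%:R + 2 * Num.sqrt (m%:R * ln (1 / beta)) + 2 * ln (1 / beta)).

Definition is_metric (R : realType) (U : Type) (dist : U -> U -> R) : Prop :=
  [/\ forall x y, 0 <= dist x y,
      forall x y, dist x y = 0 <-> x = y,
      forall x y, dist x y = dist y x &
      forall x y z, dist x z <= dist x y + dist y z].

Section renyi.
Context d (V : measurableType d) (R : realType).
Variable mu : {measure set V -> \bar R}.

Definition is_density (P : set V -> \bar R) (p : V -> R) : Prop :=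
  [/\ measurable_fun setT p,
      forall y, 0 <= p y &
      forall A, measurable A -> P A = (\int[mu]_(y in A) (p y)%:E)%E].

(* p^alpha q^(1 - alpha) for alpha > 1: a negative power of q = 0 is +oo
   (whereas powR is 0 there), and the product is 0 if moreover p = 0. *)
Definition renyi_integrand (alpha p q : R) : \bar R :=
  if q == 0 then (if p == 0 then 0%E else +oo%E)
  else (p `^ alpha * q `^ (1 - alpha))%:E.

(* Renyi divergence of order alpha > 1 of the distribution with density p from
   the one with density q *)
Definition renyi_div (alpha : R) (p q : V -> R) : \bar R :=
  (((alpha - 1)^-1)%:E
     * lne (\int[mu]_y renyi_integrand alpha (p y) (q y)))%E.

(* rho-concentrated geo-privacy of a mechanism given by its output
   distributions law x, which are required to have densities. *)
Definition cgp (U : Type) (dist : U -> U -> R) (rho : R)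
    (law : U -> probability V R) : Prop :=
  (forall x, exists p, is_density (law x) p) /\
  forall x x' (alpha : R) p q, 1 < alpha ->
    is_density (law x) p -> is_density (law x') q ->
    (renyi_div alpha p q <= (alpha * rho * dist x x' ^+ 2)%:E)%E.

End renyi.

Section mechanism.
Context (R : realType) (m : nat).
Variables (rho : R) (S : 'M[R]_m) (a : m.-tuple (measurableTypeR R)).

(* z |-> a + (1 / sqrt (2 rho)) S z *)
Definition perturb (z : m.-tuple (measurableTypeR R)) :
    m.-tuple (measurableTypeR R) :=
  [tuple tnth a i + (Num.sqrt (2 * rho))^-1
           * (S *m (\col_j (tnth z j : R))) i 0 | i < m].

Lemma measurable_perturb : measurable_fun setT perturb.
Proof.
apply/measurable_fun_tnthP => i.
rewrite (_ : _ \o _ = fun z => tnth a i + (Num.sqrt (2 * rho))^-1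
    * \sum_(j < m) S i j * (tnth z j : R)); last first.
  apply/funext => z /=; rewrite tnth_mktuple mxE; congr (_ + _ * _).
  by apply: eq_bigr => j _; rewrite mxE.
apply: measurable_funD => //; apply: measurable_funM => //.
apply: measurable_sum => j; apply: measurable_funM => //.
exact: (@measurable_tnth _ (measurableTypeR R)).
Qed.

HB.instance Definition _ :=
  isMeasurableFun.Build _ _ _ _ perturb measurable_perturb.

End mechanism.

(* Main.v *)
(** Write [G] for the Gram matrix of the [phi_j] and [S] for the square root of
    [G^-1], so that [S G S = 1]. Then [dist_2 (f_a, f_b)^2 = (a - b)^T G (a - b)]
    and [dist_2 (f_(M a), f_a) = |Z| / sqrt (2 rho)], which reduces the two
    accuracy claims to the norm of a standard Gaussian vector: its tail is
    Chernoff's bound with [E exp (t |Z|^2) = (1 - 2t)^(-m/2)], and its mean comes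
    from comparing the two scale-invariant measures [|x|^-m dx] on [R^m] and
    [du / u] on the half-line, without polar coordinates.

    For privacy, the laws of [M a] and [M a'] are the images, under one affine
    bijection, of a standard Gaussian shifted by [b] and unshifted, where
    [|b|^2 = 2 rho dist_2 (f_a, f_a')^2]. The Renyi divergence does not see the
    bijection, and equals [alpha |b|^2 / 2] by the Cameron-Martin formula. Densities
    exist because an affine bijection preserves Lebesgue null sets, which only
    uses the translation invariance of Lebesgue measure. *)

Require Import Defs.
From HB Require Import structures.
From mathcomp Require Import all_boot all_order all_algebra.
From mathcomp Require Import all_classical all_reals all_analysis.
From mathcomp Require Import measurable_realfun.
From mathcomp Require Import ring lra spectral complex.

Set Implicit Arguments.
Unset Strict Implicit.
Unset Printing Implicit Defensive.

Import Order.TTheory GRing.Theory Num.Theory.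
Import numFieldNormedType.Exports.

Local Open Scope classical_set_scope.
Local Open Scope ring_scope.

(** * Densities and product measures *)

(** Privacy is stated for every pair of versions [p], [q] of the densities, known only up to null
    sets. The integral over Lebesgue measure is therefore traded for that of h^alpha against the
    second law, with [h] the density of the first law with respect to the second; no determinant and
    no explicit density of [M a] enters.

    In the radial comparison, exchanging the orders of integration leaves an unknown factor that
    depends on [F] only. Two choices of [G] with the same [F] eliminate it. Dividing in the extended
    reals requires a quantity that is neither 0 nor infinite; testing against the indicator of
    [[1, 2]] shows this of the integral defining Gamma(m / 2). The bound by sqrt(m) is not an
    estimate of a Gamma quotient: it bounds the mean itself, through the second moment.

    The root [S] is picked by choice, so one must be exhibited. The spectral theorem is applied over
    the complex numbers, and a real polynomial in the matrix brings the root back to the reals. *)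

Section density.
Import HBNNSimple.
Local Open Scope ereal_scope.
Context d (T : measurableType d) (R : realType).
Variables (mu nu : {measure set T -> \bar R}) (q : T -> R).
Hypothesis q0 : forall x, (0 <= q x)%R.
Hypothesis mq : measurable_fun setT q.
Hypothesis nuE : forall A, measurable A -> nu A = \int[mu]_(x in A) (q x)%:E.

Let integral_density_nnsfun (h : {nnsfun T >-> R}) :
  \int[nu]_x (h x)%:E = \int[mu]_x ((h x)%:E * (q x)%:E).
Proof.
under [LHS]eq_integral do rewrite fimfunE -fsumEFin//.
rewrite [LHS]ge0_integral_fsum//; last 2 first.
  - by move=> r; exact/measurable_EFinP/measurableT_comp.
  - by move=> n x _; rewrite EFinM nnfun_muleindic_ge0.
under [RHS]eq_integral.
  move=> x _; rewrite fimfunE -fsumEFin// ge0_mule_fsuml; last first.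
    by move=> r; exact: nnfun_muleindic_ge0.
  over.
rewrite [RHS]ge0_integral_fsum//; last 2 first.
  - move=> r; apply/emeasurable_funM; last exact/measurable_EFinP.
    exact/measurable_EFinP/measurableT_comp.
  - by move=> n x _; rewrite mule_ge0 ?lee_fin// -lee_fin EFinM nnfun_muleindic_ge0.
apply: eq_fsbigr => r rhn.
rewrite integralZl_indic_nnsfun// integral_indic// setIT nuE//.
under [RHS]eq_integral do rewrite EFinM -muleA.
rewrite ge0_integralZl//.
- congr (_ * _); rewrite integral_mkcond; apply: eq_integral => x _.
  by rewrite epatch_indic muleC.
- apply: emeasurable_funM; exact/measurable_EFinP.
- by move=> t _; rewrite mule_ge0 ?lee_fin.
- by move: rhn; rewrite inE => -[t _ <-]; rewrite lee_fin.
Qed.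

Lemma ge0_integral_density (f : T -> \bar R) :
  measurable_fun setT f -> (forall x, 0 <= f x) ->
  \int[nu]_x f x = \int[mu]_x (f x * (q x)%:E).
Proof.
move=> mf f0; pose h := nnsfun_approx measurableT mf.
have fE x : f x = limn (fun n => (h n x)%:E).
  by apply/esym/cvg_lim => //; exact: cvg_nnsfun_approx.
have ndh x : nondecreasing_seq (fun n => (h n x)%:E).
  by move=> a b ab; rewrite lee_fin; exact/lefP/nd_nnsfun_approx.
under [LHS]eq_integral do rewrite fE.
rewrite monotone_convergence//; last 2 first.
  - by move=> n; exact/measurable_EFinP.
  - by move=> n x _; rewrite lee_fin.
under eq_fun do rewrite integral_density_nnsfun.
rewrite -monotone_convergence//.
- apply: eq_integral => x _; rewrite limeMr ?fE//.
  exact: ereal_nondecreasing_is_cvgn.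
- by move=> n; apply: emeasurable_funM; exact/measurable_EFinP.
- by move=> n x _; rewrite mule_ge0 ?lee_fin.
- by move=> x _ a b ab; rewrite lee_wpmul2r ?lee_fin// -lee_fin ndh.
Qed.

End density.

Section tuple_integral.
Local Open Scope ereal_scope.
Context d (T : measurableType d) (R : realType).

(** Tonelli through the pushforward by [tuple_cons]: inductions on the dimension peel off the first
    coordinate with it. *)
Lemma ge0_integral_tuple_measureS
    (mu : {sigma_finite_measure set T -> \bar R}) n (f : n.+1.-tuple T -> \bar R) :
  measurable_fun setT f -> (forall t, 0 <= f t) ->
  \int[tuple_measure mu n.+1]_t f t =
  \int[mu]_x \int[tuple_measure mu n]_t f (tuple_cons (x, t)).
Proof.
move=> mf f0.
rewrite [LHS](ge0_integral_pushforward (@measurable_tuple_cons _ T n))//.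
rewrite preimage_setT (fubini_tonelli1 (f \o _))//.
by apply: measurableT_comp => //; exact: measurable_tuple_cons.
by move=> x; exact: f0.
Qed.

Lemma measurable_integral_tuple_cons
    (mu : {sigma_finite_measure set T -> \bar R}) n (f : n.+1.-tuple T -> \bar R) :
  measurable_fun setT f -> (forall t, 0 <= f t) ->
  measurable_fun setT (fun x => \int[tuple_measure mu n]_t f (tuple_cons (x, t))).
Proof.
move=> mf f0.
apply: (@measurable_fun_fubini_tonelli_F _ _ _ _ _ (tuple_measure mu n) (f \o _)) => //=.
  by apply: measurableT_comp => //; exact: measurable_tuple_cons.
Qed.

Lemma measurable_tuple_consr n (x : T) :
  measurable_fun setT (fun t : n.-tuple T => tuple_cons (x, t)).
Proof. by apply: (@measurable_cons _ _ _ _ (cst x) _ id). Qed.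

Lemma integral_tuple_measure0 (mu : {sigma_finite_measure set T -> \bar R})
    (f : 0.-tuple T -> \bar R) :
  \int[tuple_measure mu 0]_t f t = f [tuple].
Proof.
rewrite (_ : f = cst (f [tuple])); last by apply/funext => t; rewrite (tuple0 t).
by rewrite integral_dirac// diracE in_setT mul1e.
Qed.

Lemma tnth_tuple_cons n (x : T) (t : n.-tuple T) :
  (tnth (tuple_cons (x, t)) ord0 = x) *
  (forall i, tnth (tuple_cons (x, t)) (lift ord0 i) = tnth t i).
Proof. by split=> [|i]; rewrite ?tnth0// tnthS. Qed.

Lemma measurable_prod_tnth n (q : T -> R) : measurable_fun setT q ->
  measurable_fun setT (fun t : n.-tuple T => \prod_(i < n) q (tnth t i))%R.
Proof.
move=> mq; apply: measurable_prod => i _.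

apply: (measurableT_comp mq).
exact: measurable_tnth.
Qed.

Lemma ge0_integral_tuple_density
    (mu nu : {sigma_finite_measure set T -> \bar R}) (q : T -> R) :
  (forall x, (0 <= q x)%R) -> measurable_fun setT q ->
  (forall A, measurable A -> nu A = \int[mu]_(x in A) (q x)%:E) ->
  forall n (f : n.-tuple T -> \bar R),
  measurable_fun setT f -> (forall t, 0 <= f t) ->
  \int[tuple_measure nu n]_t f t =
  \int[tuple_measure mu n]_t (f t * (\prod_(i < n) q (tnth t i))%:E).
Proof.
move=> q0 mq nuE; elim=> [|n IH] f mf f0.
  by rewrite !integral_tuple_measure0 big_ord0 mule1.
have mfq : measurable_fun [set: n.+1.-tuple T] (fun t =>
    f t * (\prod_(i < n.+1) q (tnth t i))%:E).
  apply: emeasurable_funM => //; apply/measurable_EFinP.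
  exact: measurable_prod_tnth.
rewrite !ge0_integral_tuple_measureS//; last first.
  by move=> t; rewrite mule_ge0// lee_fin prodr_ge0.
rewrite (ge0_integral_density q0 mq nuE); last 2 first.
- exact: measurable_integral_tuple_cons.
- by move=> x; exact: integral_ge0.
apply: eq_integral => x _; rewrite IH//; last first.
  by apply: measurableT_comp => //; exact: measurable_tuple_consr.
rewrite -ge0_integralZr//; last 3 first.
- apply: emeasurable_funM.
    by apply: measurableT_comp => //; exact: measurable_tuple_consr.
  by apply/measurable_EFinP; exact: measurable_prod_tnth.
- by move=> t _; rewrite mule_ge0// lee_fin prodr_ge0.
- by rewrite lee_fin.
apply: eq_integral => t _; rewrite -muleA; congr (_ * _).
rewrite big_ord_recl !tnth_tuple_cons -EFinM mulrC; congr (_ * _)%:E.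
by apply: eq_bigr => i _; rewrite tnth_tuple_cons.
Qed.

End tuple_integral.

(* The canonical measure structure of pushforward needs a proof of
   measurability, which unification cannot supply. *)
Definition pushforward_measure d1 d2 (T1 : measurableType d1)
    (T2 : measurableType d2) (R : realType) (mu : {measure set T1 -> \bar R})
    (f : T1 -> T2) (mf : measurable_fun setT f) : {measure set T2 -> \bar R} :=
  measure_function_pushforward__canonical__measure_function_Measure mu mf.

(** * Affine changes of variables *)

Section affine.
Local Open Scope ereal_scope.
Context (R : realType).
Local Notation leb := (@lebesgue_measure R).

(** By uniqueness of Lebesgue measure: its image under x -> k x + b, rescaled by [k], gives
    half-open intervals their length. *)
Lemma ge0_integral_affine (k b : R) (f : R -> \bar R) : (0 < k)%R ->
  measurable_fun setT f -> (forall x, 0 <= f x) ->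
  k%:E * \int[leb]_x f (k * x + b)%R = \int[leb]_x f x.
Proof.
move=> k0 mf f0.
pose phi (x : measurableTypeR R) : measurableTypeR R := (k * x + b)%R.
have mphi : measurable_fun setT phi.
  by apply: measurable_funD => //; apply: measurable_funM => //; exact: measurable_id.
pose kp : {nonneg R} := NngNum (ltW k0).
pose nu : {measure set (measurableTypeR R) -> \bar R} :=
  mscale kp (pushforward_measure leb mphi).
have nuE A : measurable A -> leb A = nu A.
  move=> mA; apply: lebesgue_measure_unique => //= _ [[a c]] /= _ <-.
  rewrite /mscale/= /pushforward_measure /= /pushforward.
  have -> : phi @^-1` `]a, c] = `]((a - b) / k)%R, ((c - b) / k)%R]%classic.
    apply/seteqP; split => x /=; rewrite !in_itv/= ltr_pdivrMr// ler_pdivlMr//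
      ltrBlDr lerBrDr (mulrC x); by [].
  rewrite !lebesgue_measure_itv/= !lte_fin ltr_pM2r ?invr_gt0// ltrD2r.
  case: ifPn => [ac|_]; last by rewrite mule0.
  rewrite -!EFinB -EFinM; congr EFin.
  by rewrite -mulrBl opprB addrA subrK mulrCA mulfV ?gt_eqF// mulr1.
rewrite [RHS](eq_measure_integral nu); last by move=> A mA _; exact: nuE.
rewrite ge0_integral_mscale//; congr (_ * _).
by rewrite ge0_integral_pushforward.
Qed.

Definition affine_tuple m (k : R) (b t : m.-tuple (measurableTypeR R)) :
    m.-tuple (measurableTypeR R) :=
  [tuple (k * (tnth t i : R) + (tnth b i : R))%R | i < m].

Lemma measurable_affine_tuple m k b : measurable_fun setT (@affine_tuple m k b).
Proof.
apply/measurable_fun_tnthP => i.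
rewrite (_ : _ \o _ = fun t => (k * (tnth t i : R) + (tnth b i : R))%R); last first.
  by apply/funext => t; rewrite /= tnth_mktuple.
apply: measurable_funD => //; apply: measurable_funM => //.
exact: (@measurable_tnth _ (measurableTypeR R)).
Qed.

Lemma affine_tuple_cons m k (b : m.+1.-tuple (measurableTypeR R)) x t :
  affine_tuple k b (tuple_cons (x, t)) =
  tuple_cons ((k * x + thead b)%R, affine_tuple k [tuple of behead b] t).
Proof.
apply: eq_from_tnth => i; rewrite tnth_mktuple.
case: (unliftP ord0 i) => [j|] ->; rewrite !tnth_tuple_cons ?tnth_mktuple//.
by rewrite {1}(tuple_eta b) tnthS.
Qed.

(** All coordinates share the factor [k], so the Jacobian [k ^+ m] builds up one coordinate at a
    time. Translations ([k = 1]) and dilations ([b] zero) are the two cases used. *)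
Lemma ge0_integral_affine_tuple m k b (f : m.-tuple (measurableTypeR R) -> \bar R) :
  (0 < k)%R -> measurable_fun setT f -> (forall t, 0 <= f t) ->
  (k ^+ m)%:E * \int[borel_measure_Rm R m]_t f (affine_tuple k b t) =
  \int[borel_measure_Rm R m]_t f t.
Proof.
move=> k0; elim: m b f => [|m IH] b f mf f0.
  rewrite !integral_tuple_measure0 mul1e; congr f.
  by rewrite (tuple0 (affine_tuple _ _ _)).
have mfa : measurable_fun setT (f \o affine_tuple k b).
  by apply: measurableT_comp => //; exact: measurable_affine_tuple.
rewrite /borel_measure_Rm !ge0_integral_tuple_measureS//.
rewrite -[RHS](ge0_integral_affine (thead b) k0); last 2 first.
- exact: (@measurable_integral_tuple_cons _ (measurableTypeR R) R leb m f).
- by move=> x; exact: integral_ge0.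
transitivity (k%:E * ((k ^+ m)%:E *
    \int[leb]_x \int[tuple_measure leb m]_t f (affine_tuple k b (tuple_cons (x, t))))).
  by rewrite exprS EFinM muleA.
congr (_ * _); rewrite -ge0_integralZl//; last 3 first.
- exact: (@measurable_integral_tuple_cons _ (measurableTypeR R) R leb m
    (f \o affine_tuple k b) mfa (fun t => f0 _)).
- by move=> x _; exact: integral_ge0.
- by rewrite lee_fin exprn_ge0// ltW.
apply: eq_integral => x _.
under eq_integral do rewrite affine_tuple_cons.
rewrite (IH [tuple of behead b] (fun t => f (tuple_cons ((k * x + thead b)%R, t))))//.
by apply: measurableT_comp => //; exact: measurable_tuple_consr.
Qed.
End affine.

(** * The standard Gaussian on tuples *)

Section gaussian.
Local Open Scope ereal_scope.
Context (R : realType) (m : nat).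
Local Notation leb := (@lebesgue_measure R).
Local Notation Rm := (m.-tuple (measurableTypeR R)).
Implicit Types b z : Rm.

Definition tdot b z : R := (\sum_(i < m) (tnth b i : R) * (tnth z i : R))%R.

Definition sqnorm z : R := (\sum_(i < m) (tnth z i : R) ^+ 2)%R.

Lemma measurable_tdot b : measurable_fun setT (tdot b).
Proof.
apply: measurable_sum => j; apply: measurable_funM => //.
exact: (@measurable_tnth _ (measurableTypeR R)).
Qed.

Lemma measurable_sqnorm : measurable_fun setT sqnorm.
Proof.
apply: measurable_sum => j; apply: measurable_funX => //.
exact: (@measurable_tnth _ (measurableTypeR R)).
Qed.

Lemma sqnorm_ge0 z : (0 <= sqnorm z)%R.
Proof. by apply: sumr_ge0 => i _; rewrite sqr_ge0. Qed.

Lemma sqnorm_affine (k : R) b z : sqnorm (affine_tuple k b z) =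
  (k ^+ 2 * sqnorm z + 2 * k * tdot b z + sqnorm b)%R.
Proof.
rewrite /sqnorm /tdot !mulr_sumr -!big_split/=; apply: eq_bigr => i _.
rewrite tnth_mktuple; ring.
Qed.

(** The witness is the zero vector; hiding it lets dilations be treated as instances of
    [affine_tuple]. *)
Lemma sqnorm_dilation :
  exists b, forall (k : R) z, sqnorm (affine_tuple k b z) = (k ^+ 2 * sqnorm z)%R.
Proof.
exists [tuple of nseq m (0%R : measurableTypeR R)] => k z.
rewrite /sqnorm mulr_sumr; apply: eq_bigr => i _.
by rewrite tnth_mktuple tnth_nseq addr0 exprMn.
Qed.

Lemma measurable_norm : measurable_fun setT (fun z => Num.sqrt (sqnorm z)).
Proof.
rewrite (_ : (fun z => _) = (fun z => (sqnorm z `^ 2^-1)%R)); last first.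
  by apply/funext => z; rewrite powR12_sqrt// sqnorm_ge0.
exact: (measurableT_comp (measurable_powR _) measurable_sqnorm).
Qed.

Definition gauss_density z : R :=
  (normal_peak 1 ^+ m * expR (- sqnorm z / 2))%R.

Lemma gauss_density_gt0 z : (0 < gauss_density z)%R.
Proof. by rewrite mulr_gt0 ?expR_gt0// exprn_gt0// normal_peak_gt0. Qed.

Lemma gauss_density_ge0 z : (0 <= gauss_density z)%R.
Proof. exact/ltW/gauss_density_gt0. Qed.

Lemma measurable_gauss_density : measurable_fun setT gauss_density.
Proof.
apply: measurable_funM => //; apply: measurableT_comp => //.
by apply: measurable_funM => //; apply: measurable_funN; exact: measurable_sqnorm.
Qed.

Lemma prod_normal_pdf z :
  (\prod_(i < m) normal_pdf 0 1 (tnth z i : R))%R = gauss_density z.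
Proof.
rewrite /gauss_density /sqnorm -sumrN mulr_suml expR_sum.
rewrite (_ : (normal_peak 1 ^+ m)%R = (\prod_(i < m) (normal_peak 1 : R))%R); last first.
  by rewrite prodr_const card_ord.
rewrite -big_split/=; apply: eq_bigr => i _; rewrite normal_pdfE//.
by rewrite /normal_fun subr0 expr1n.
Qed.

Lemma ge0_integral_std_gaussian (f : Rm -> \bar R) :
  measurable_fun setT f -> (forall t, 0 <= f t) ->
  \int[std_gaussian R m]_z f z =
  \int[borel_measure_Rm R m]_z (f z * (gauss_density z)%:E).
Proof.
move=> mf f0.
rewrite /std_gaussian (@ge0_integral_tuple_density _ (measurableTypeR R) R leb
  (normal_prob 0 1) (normal_pdf 0 1))//.
- by apply: eq_integral => z _; rewrite prod_normal_pdf.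
- by move=> x; exact: normal_pdf_ge0.
- exact: measurable_normal_pdf.
Qed.

End gaussian.

Lemma std_gaussian_setT (R : realType) m : std_gaussian R m setT = 1%E.
Proof.
rewrite -[LHS]mul1e -integral_cst//.
elim: m => [|m IH]; first by rewrite integral_tuple_measure0.
rewrite /std_gaussian ge0_integral_tuple_measureS//.
rewrite (eq_integral (cst 1%E)) => [|x _]; last exact: IH.
by rewrite integral_cst// mul1e; exact: probability_setT.
Qed.

Section gaussian_moments.
Local Open Scope ereal_scope.
Context (R : realType) (m : nat).
Local Notation leb := (@lebesgue_measure R).
Local Notation Rm := (m.-tuple (measurableTypeR R)).
Implicit Types b z : Rm.

Lemma integral_gauss_density :
  \int[borel_measure_Rm R m]_z (gauss_density z)%:E = 1.
Proof.
rewrite -(std_gaussian_setT R m) -[RHS]mul1e -integral_cst//.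
rewrite ge0_integral_std_gaussian//.
by apply: eq_integral => z _; rewrite mul1e.
Qed.

(** With k^2 = 1 - 2t, the factor exp(t |z|^2) turns the density at [z] into the density at k z, and
    a dilation finishes. The parameter [k] keeps the real power (1 - 2t)^(-m/2) an integer one. *)
Lemma gauss_mgf_sqnorm (k : R) : (0 < k)%R ->
  \int[std_gaussian R m]_z (expR ((1 - k ^+ 2) / 2 * sqnorm z))%:E =
  ((k ^+ m)^-1)%:E.
Proof.
move=> k0; rewrite ge0_integral_std_gaussian//; last first.
  apply/measurable_EFinP/measurableT_comp => //; apply: measurable_funM => //.
  exact: measurable_sqnorm.
have [b0 nE] := sqnorm_dilation R m.
transitivity (\int[borel_measure_Rm R m]_z (gauss_density (affine_tuple k b0 z))%:E).
  apply: eq_integral => z _; rewrite -EFinM; congr EFin.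
  rewrite /gauss_density mulrCA; congr (_ * _)%R; rewrite -expRD; congr expR.
  by rewrite nE; field.
have kn0 : (k ^+ m)%R != 0%R by rewrite expf_neq0// gt_eqF.
transitivity (((k ^+ m)^-1)%:E * ((k ^+ m)%:E *
    \int[borel_measure_Rm R m]_z (gauss_density (affine_tuple k b0 z))%:E)).
  by rewrite muleA -EFinM mulVf// mul1e.
rewrite (ge0_integral_affine_tuple b0 (f := EFin \o @gauss_density R m))//.
- by rewrite integral_gauss_density mule1.
- apply/measurable_EFinP; exact: measurable_gauss_density.
- by move=> z; rewrite lee_fin gauss_density_ge0.
Qed.

(** Translating the right-hand integral by [b] leaves a pointwise identity: the exponent <b, z + b>
    - |b|^2 / 2 compensates exactly for |z + b|^2 in place of |z|^2 in the density. *)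
Lemma gauss_shift b (f : Rm -> \bar R) :
  measurable_fun setT f -> (forall t, 0 <= f t) ->
  \int[std_gaussian R m]_z f (affine_tuple 1 b z) =
  \int[std_gaussian R m]_z (f z * (expR (tdot b z - sqnorm b / 2))%:E).
Proof.
move=> mf f0.
have mfa : measurable_fun setT (f \o affine_tuple 1 b).
  by apply: measurableT_comp => //; exact: measurable_affine_tuple.
have mh : measurable_fun setT (fun z => (expR (tdot b z - sqnorm b / 2))%:E).
  apply/measurable_EFinP/measurableT_comp => //; apply: measurable_funB => //.
  exact: measurable_tdot.
have mg : measurable_fun setT (fun z : Rm => (gauss_density z)%:E).
  by apply/measurable_EFinP; exact: measurable_gauss_density.
rewrite !ge0_integral_std_gaussian//; last 2 first.
- by apply: emeasurable_funM.
- by move=> z; rewrite mule_ge0// lee_fin expR_ge0.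
rewrite -[RHS](ge0_integral_affine_tuple b ltr01); last 2 first.
- by apply: emeasurable_funM => //; apply: emeasurable_funM.
- by move=> z; rewrite !mule_ge0// lee_fin ?expR_ge0 ?gauss_density_ge0.
rewrite expr1n mul1e; apply: eq_integral => z _; rewrite -muleA; congr (_ * _).
rewrite -EFinM; congr EFin; rewrite /gauss_density mulrCA; congr (_ * _)%R.
rewrite -expRD; congr expR; rewrite sqnorm_affine.
have -> : tdot b (affine_tuple 1 b z) = (tdot b z + sqnorm b)%R.
  rewrite /tdot /sqnorm -big_split/=; apply: eq_bigr => i _.
  by rewrite tnth_mktuple; ring.
by field.
Qed.

(** The shift formula for r b, applied to the constant 1: the total mass is 1, and the normalising
    factor gives the value. *)
Lemma gauss_mgf_tdot b (r : R) :
  \int[std_gaussian R m]_z (expR (r * tdot b z))%:E =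
  (expR (r ^+ 2 * sqnorm b / 2))%:E.
Proof.
pose rb : Rm := [tuple (r * (tnth b i : R))%R : measurableTypeR R | i < m].
have one : \int[std_gaussian R m]_z (cst 1 z : \bar R) = 1.
  by rewrite integral_cst// mul1e; exact: std_gaussian_setT.
have := @gauss_shift rb (cst 1) (measurable_cst _) (fun=> lee01).
rewrite [in X in X -> _]one.
have -> : sqnorm rb = (r ^+ 2 * sqnorm b)%R.
  by rewrite /sqnorm mulr_sumr; apply: eq_bigr => i _; rewrite tnth_mktuple exprMn.
under [X in _ = X -> _]eq_integral => z _.
  rewrite mul1e (_ : tdot rb z = (r * tdot b z)%R); last first.
    by rewrite /tdot mulr_sumr; apply: eq_bigr => i _; rewrite tnth_mktuple mulrA.
  rewrite expRD EFinM muleC; over.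
rewrite ge0_integralZl//; last first.
  apply/measurable_EFinP/measurableT_comp => //; apply: measurable_funM => //.
  exact: measurable_tdot.
move=> h; rewrite -[LHS]mul1e (_ : 1 = (expR (r ^+ 2 * sqnorm b / 2))%:E *
    (expR (- (r ^+ 2 * sqnorm b / 2)))%:E).
  by rewrite -muleA -h mule1.
by rewrite -EFinM -expRD subrr expR0.
Qed.

End gaussian_moments.

(** * Lebesgue null sets and densities *)

Section null_preimage.
Local Open Scope ereal_scope.
Context (R : realType) (m : nat).
Local Notation leb := (borel_measure_Rm R m).
Local Notation Rm := (m.-tuple (measurableTypeR R)).

Lemma ge0_integral_translation (b : Rm) (f : Rm -> \bar R) :
  measurable_fun setT f -> (forall t, 0 <= f t) ->
  \int[leb]_t f (affine_tuple 1 b t) = \int[leb]_t f t.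
Proof.
by move=> mf f0; rewrite -[RHS](ge0_integral_affine_tuple b ltr01)// expr1n mul1e.
Qed.

Lemma borel_measure_Rm_setT_neq0 : leb setT != 0.
Proof.
apply/eqP => leb0; have := integral_gauss_density R m.
rewrite null_set_integral//; last by
  apply/measurable_EFinP; exact: measurable_gauss_density.
by move=> /esym/eqP; rewrite onee_eq0.
Qed.

Lemma measurable_affine_pair (T : Rm -> Rm) : measurable_fun setT T ->
  measurable_fun setT (fun x : Rm * Rm => affine_tuple 1 x.2 (T x.1)).
Proof.
move=> mT; apply/measurable_fun_tnthP => i.
rewrite (_ : _ \o _ = fun x : Rm * Rm => ((tnth (T x.1) i : R) + (tnth x.2 i : R))%R);
  last by apply/funext => x; rewrite /= tnth_mktuple mul1r.
have mi := @measurable_tnth _ (measurableTypeR R) m i.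
apply: measurable_funD.
  exact: (measurableT_comp mi (measurableT_comp mT measurable_fst)).
exact: (measurableT_comp mi measurable_snd).
Qed.

(* The pushforward of Lebesgue measure by T is translation invariant, so
   integrating 1_A (T x + y) over y and over x in both orders gives
   leb setT * leb (T @^-1` A) = 0. *)
Lemma null_preimage_equivariant (T K : Rm -> Rm) (A : set Rm) :
  measurable_fun setT T ->
  (forall x y, affine_tuple 1 y (T x) = T (affine_tuple 1 (K y) x)) ->
  measurable A -> leb A = 0 -> leb (T @^-1` A) = 0.
Proof.
move=> mT TK mA A0.
have mTA : measurable (T @^-1` A) by rewrite -[X in measurable X]setTI; exact: mT.
pose f (x : Rm * Rm) : \bar R := (\1_A (affine_tuple 1 x.2 (T x.1)))%:E.
have mf : measurable_fun setT f.
  apply/measurable_EFinP; apply: (measurableT_comp (measurable_indic mA)).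
  exact: measurable_affine_pair.
have f0 x : 0 <= f x by rewrite lee_fin.
have /esym := fubini_tonelli (m1 := leb) (m2 := leb) f mf f0.
rewrite [RHS]integral0_eq => [|x _]; last first.
  rewrite /f /=.
  transitivity (\int[leb]_y (EFin \o \1_A) (affine_tuple 1 (T x) y)).
    apply: eq_integral => y _ /=; congr (\1_A _)%:E.
    by apply: eq_from_tnth => i; rewrite !tnth_mktuple !mul1r addrC.
  rewrite ge0_integral_translation//; last 2 first.
  - by apply/measurable_EFinP; exact: measurable_indic.
  - by move=> t; rewrite lee_fin.
  by rewrite integral_indic// setIT.
rewrite (eq_integral (cst (leb (T @^-1` A)))) => [|y _]; last first.
  rewrite /f /=; under eq_integral do rewrite TK.
  rewrite (ge0_integral_translation (K y) (f := EFin \o (\1_(T @^-1` A)))); last 2 first.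
  - by apply/measurable_EFinP; exact: measurable_indic.
  - by move=> t; rewrite lee_fin.
  by rewrite integral_indic// setIT.
rewrite integral_cst// => /eqP; rewrite mule_eq0 (negbTE borel_measure_Rm_setT_neq0) orbF.
by move/eqP.
Qed.

Lemma std_gaussian_null (A : set Rm) : measurable A -> leb A = 0 ->
  std_gaussian R m A = 0.
Proof.
move=> mA A0.
rewrite -[A]setIT -integral_indic// ge0_integral_std_gaussian//; last first.
  by apply/measurable_EFinP; exact: measurable_indic.
transitivity (\int[leb]_(z in A) (gauss_density z)%:E).
  by rewrite [RHS]integral_mkcond; apply: eq_integral => z _; rewrite epatch_indic muleC.
apply: null_set_integral => //.
by apply: measurable_funTS; apply/measurable_EFinP; exact: measurable_gauss_density.
Qed.

End null_preimage.

(** Radon-Nikodym; the derivative is finite at every point, so [fine] makes it real-valued without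
    changing it. *)
Lemma density_ex d (V : measurableType d) (R : realType)
    (nu : {finite_measure set V -> \bar R})
    (mu : {sigma_finite_measure set V -> \bar R}) :
  (forall A, measurable A -> mu A = 0 -> nu A = 0)%E ->
  exists p, is_density mu nu p.
Proof.
move=> /null_content_dominatesP numu.
pose f := Radon_Nikodym_SigmaFinite.f nu mu.
have f0 x : (0 <= f x)%E by exact: Radon_Nikodym_SigmaFinite.f_ge0.
have ff x : f x \is a fin_num by exact: Radon_Nikodym_SigmaFinite.f_fin_num.
exists (fine \o f); split.
- apply: (measurableT_comp (fine_measurable measurableT)) => //.
  by have /measurable_int := Radon_Nikodym_SigmaFinite.f_integrable numu.
- by move=> y; exact: fine_ge0.
- move=> A mA; rewrite (Radon_Nikodym_SigmaFinite.f_integral numu)//.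
  by apply: eq_integral => x _; rewrite /= fineK.
Qed.

(** * Renyi divergence *)

Section renyi_change.
Local Open Scope ereal_scope.
Context d (V : measurableType d) (R : realType).
Variables (mu : {sigma_finite_measure set V -> \bar R}).
Variables (P Q : probability V R) (p q h : V -> R) (alpha : R).
Hypotheses (Pp : is_density mu P p) (Qq : is_density mu Q q).
Hypotheses (mh : measurable_fun setT h) (h0 : forall y, (0 <= h y)%R).
Hypothesis Ph : forall A, measurable A -> P A = \int[Q]_(y in A) (h y)%:E.

(** The versions [p] and [q] are arbitrary, so p = h q can be expected only almost everywhere; both
    sides have the same integral over every measurable set. *)
Let density_ae_eq : ae_eq mu setT (EFin \o p) (EFin \o (h \* q)%R).
Proof.
have [mp p0 pE] := Pp; have [mq q0 qE] := Qq.
have mhq : measurable_fun setT (EFin \o (h \* q)%R).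
  by apply/measurable_EFinP; exact: measurable_funM.
apply: integral_ae_eq => //.
  apply/integrableP; split; first exact/measurable_EFinP.
  under eq_integral do rewrite /= ger0_norm//.
  by rewrite -pE// probability_setT ltry.
move=> A _ mA; rewrite /= -pE// Ph// integral_mkcond.
have mhA : measurable_fun setT ((EFin \o h) \_ A).
  apply/(measurable_restrictT _ _).1 => //.
  by apply: measurable_funTS; exact/measurable_EFinP.
rewrite (ge0_integral_density q0 mq qE)//; last first.
  by apply: erestrict_ge0 => y _; rewrite lee_fin.
rewrite [RHS]integral_mkcond; apply: eq_integral => y _.
by rewrite !patchE; case: ifPn => _ /=; rewrite ?mul0e.
Qed.

Let measurable_renyi_integrand :
  measurable_fun setT (fun y => renyi_integrand alpha (p y) (q y)).
Proof.
have [mp p0 pE] := Pp; have [mq q0 qE] := Qq.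
apply: measurable_fun_ifT; first exact: measurable_fun_eqr.
  by apply: measurable_fun_ifT => //; exact: measurable_fun_eqr.
apply/measurable_EFinP; apply: measurable_funM.
  exact: (measurableT_comp (measurable_powR alpha) mp).
exact: (measurableT_comp (measurable_powR (1 - alpha)%R) mq).
Qed.

(** Where [q] is nonzero, (h q)^alpha q^(1 - alpha) = h^alpha q. Where [q] vanishes, so does [p]
    almost everywhere, and the value [+oo] of the integrand is met only on a null set. *)
Lemma integral_renyi_integrand :
  \int[mu]_y renyi_integrand alpha (p y) (q y) = \int[Q]_y (h y `^ alpha)%:E.
Proof.
have [mp p0 pE] := Pp; have [mq q0 qE] := Qq.
have mha : measurable_fun setT (fun y => (h y `^ alpha)%:E).
  apply/measurable_EFinP; exact: (measurableT_comp (measurable_powR alpha) mh).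
rewrite (ge0_integral_density q0 mq qE)//; last first.
  by move=> y; rewrite lee_fin powR_ge0.
apply: ge0_ae_eq_integral => //.
- by apply: emeasurable_funM => //; exact/measurable_EFinP.
- move=> y _; rewrite /renyi_integrand; case: ifPn => _; first by case: ifPn.
  by rewrite lee_fin mulr_ge0// powR_ge0.
- by move=> y _; rewrite mule_ge0// lee_fin// powR_ge0.
- move: density_ae_eq; apply: filterS => y /= /(_ I) [pE'] _.
  rewrite /renyi_integrand pE'; have [q00|qn0] := eqVneq (q y) 0%R.
    by rewrite q00 mulr0 eqxx mule0.
  rewrite -EFinM; congr EFin; rewrite powRM// -mulrA -powRD; last first.
    by rewrite qn0 implybT.
  by rewrite addrC subrK powRr1.
Qed.

End renyi_change.

Section gauss_renyi.
Local Open Scope ereal_scope.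
Context (R : realType) (m : nat).
Local Notation leb := (borel_measure_Rm R m).
Local Notation N := (std_gaussian R m).
Local Notation Rm := (m.-tuple (measurableTypeR R)).

Lemma ge0_integral_gauss_law (T : Rm -> Rm) (Q : probability Rm R)
    (f : Rm -> \bar R) : measurable_fun setT T ->
  (forall A, measurable A -> Q A = N (T @^-1` A)) ->
  measurable_fun setT f -> (forall y, 0 <= f y) ->
  \int[Q]_y f y = \int[N]_z f (T z).
Proof.
move=> mT QE mf f0.
rewrite [LHS](eq_measure_integral (pushforward_measure N mT)); last first.
  by move=> A mA _; exact: QE.
by rewrite [LHS]ge0_integral_pushforward.
Qed.

(* Both laws are the image under T' of a Gaussian, one of them shifted by b, and
   the shift has density exp(<b, z> - |b|^2 / 2) by Cameron-Martin. *)
Lemma gauss_renyi_div (T T' K : Rm -> Rm) (b : Rm) (P Q : probability Rm R)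
    (p q : Rm -> R) (alpha : R) :
  measurable_fun setT T' -> measurable_fun setT K -> cancel T' K ->
  (forall z, T z = T' (affine_tuple 1 b z)) ->
  (forall A, measurable A -> P A = N (T @^-1` A)) ->
  (forall A, measurable A -> Q A = N (T' @^-1` A)) ->
  (1 < alpha)%R -> is_density leb P p -> is_density leb Q q ->
  renyi_div leb alpha p q = (alpha * sqnorm b / 2)%:E.
Proof.
move=> mT' mK T'K TT' PE QE alpha1 Pp Qq.
have mT : measurable_fun setT T.
  rewrite (_ : T = T' \o affine_tuple 1 b); last exact/funext.
  by apply: measurableT_comp => //; exact: measurable_affine_tuple.
have mtK : measurable_fun setT (tdot b \o K).
  by apply: measurableT_comp => //; exact: measurable_tdot.
(* The Cameron-Martin density, read at the output [y] through the left inverse [K] of [T']. *)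
pose h y := expR (tdot b (K y) - sqnorm b / 2).
have mh : measurable_fun setT h.
  by apply: measurableT_comp => //; exact: measurable_funB.
have h0 y : (0 <= h y)%R by exact: expR_ge0.
have Ph A : measurable A -> P A = \int[Q]_(y in A) (h y)%:E.
  move=> mA; rewrite -[A in LHS]setIT -integral_indic//.
  have mi : measurable_fun setT (fun y : Rm => (\1_A y : R)%:E).
    by apply/measurable_EFinP; exact: measurable_indic.
  have i0 y : 0 <= (\1_A y : R)%:E by rewrite lee_fin.
  rewrite (ge0_integral_gauss_law mT PE mi i0).
  under eq_integral do rewrite TT'.
  rewrite (gauss_shift b (f := fun z => (\1_A (T' z))%:E)); last 2 first.
  - exact: (measurableT_comp mi mT').
  - by move=> z; exact: i0.
  rewrite [RHS]integral_mkcond.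
  have mhA : measurable_fun setT ((EFin \o h) \_ A).
    apply/(measurable_restrictT _ _).1 => //.
    by apply: measurable_funTS; exact/measurable_EFinP.
  rewrite (ge0_integral_gauss_law mT' QE mhA); last first.
    by apply: erestrict_ge0 => y _; rewrite lee_fin.
  by apply: eq_integral => z _; rewrite epatch_indic /= /h T'K muleC.
have -> : renyi_div leb alpha p q =
    ((alpha - 1)^-1)%:E * lne (\int[Q]_y (h y `^ alpha)%:E).
  by rewrite -(integral_renyi_integrand alpha Pp Qq mh h0 Ph).
have mha : measurable_fun setT (fun y => (h y `^ alpha)%:E).
  apply/measurable_EFinP; exact: (measurableT_comp (measurable_powR alpha) mh).
rewrite (ge0_integral_gauss_law mT' QE mha); last first.
  by move=> y; rewrite lee_fin powR_ge0.
have hE z : (h (T' z) `^ alpha)%:E =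
    (expR (- (alpha * (sqnorm b / 2))))%:E * (expR (alpha * tdot b z))%:E.
  rewrite -EFinM; congr EFin; rewrite /h T'K /powR gt_eqF ?expR_gt0// expRK -expRD.
  by congr expR; ring.
under eq_integral do rewrite hE.
rewrite ge0_integralZl//; last first.
  apply/measurable_EFinP/measurableT_comp => //; apply: measurable_funM => //.
  exact: measurable_tdot.
(* The exponents add up to alpha^2 |b|^2 / 2 - alpha |b|^2 / 2 = alpha (alpha - 1) |b|^2 / 2, and
   the prefactor cancels alpha - 1. *)
rewrite gauss_mgf_tdot -EFinM -expRD lne_EFin ?expR_gt0// expRK -EFinM.
congr EFin; field; rewrite subr_eq0 gt_eqF//.
Qed.

End gauss_renyi.

(** * The norm of a standard Gaussian vector *)

Section radial.
Local Open Scope ereal_scope.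
Context (R : realType) (m : nat).
Local Notation leb := (@lebesgue_measure R).
Local Notation Rm := (m.-tuple (measurableTypeR R)).
Implicit Types (F G : R -> \bar R) (x : Rm) (u c : R).

(* The densities of the scale-invariant measures du / u on the half-line and
   |x|^-m dx on R^m. *)
Definition inv_weight u : R := if (0 < u)%R then (u `^ (-1))%R else 0%R.

Definition radial_weight x : R := (sqnorm x `^ (- (m%:R / 2)))%R.

Definition mellin F := \int[leb]_u (F u * (inv_weight u)%:E).

Definition radial_mellin F :=
  \int[borel_measure_Rm R m]_x (F (sqnorm x) * (radial_weight x)%:E).

Lemma inv_weight_ge0 u : (0 <= inv_weight u)%R.
Proof. by rewrite /inv_weight; case: ifPn => // _; exact: powR_ge0. Qed.

Lemma radial_weight_ge0 x : (0 <= radial_weight x)%R.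
Proof. exact: powR_ge0. Qed.

Lemma measurable_inv_weight : measurable_fun setT inv_weight.
Proof.
apply: measurable_fun_ifT => //.
exact: measurable_fun_ltr.
Qed.

Lemma measurable_radial_weight : measurable_fun setT radial_weight.
Proof.
exact: (measurableT_comp (measurable_powR _) (@measurable_sqnorm R m)).
Qed.

Lemma mellin_scale c F : (0 < c)%R -> measurable_fun setT F ->
  (forall u, 0 <= F u) -> mellin (fun u => F (c * u)%R) = mellin F.
Proof.
move=> c0 mF F0; rewrite /mellin -[RHS](ge0_integral_affine 0 c0); last 2 first.
- by apply: emeasurable_funM => //; apply/measurable_EFinP; exact: measurable_inv_weight.
- by move=> u; rewrite mule_ge0// lee_fin inv_weight_ge0.
rewrite -ge0_integralZl//; last 3 first.
- have mc : measurable_fun setT (fun u => c * u + 0)%R.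
    by apply: measurable_funD => //; exact: mulrl_measurable.
  apply: emeasurable_funM; first exact: (measurableT_comp mF mc).
  by apply/measurable_EFinP; exact: (measurableT_comp measurable_inv_weight mc).
- by move=> u _; rewrite mule_ge0// lee_fin inv_weight_ge0.
- by rewrite lee_fin ltW.
apply: eq_integral => u _; rewrite addr0 muleCA -EFinM; congr (_ * _%:E).
rewrite /inv_weight pmulr_rgt0//; case: ifPn => [u0|_]; last by rewrite mulr0.
by rewrite powRM ?(ltW c0) ?(ltW u0)// (powR_inv1 (ltW c0)) mulrA mulfV ?mul1r// gt_eqF.
Qed.

(** The dilation by sqrt(c) multiplies |x|^2 by [c] and has Jacobian c^(m/2), which the weight
    cancels. *)
Lemma radial_mellin_scale c F : (0 < c)%R -> measurable_fun setT F ->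
  (forall u, 0 <= F u) -> radial_mellin (fun u => F (c * u)%R) = radial_mellin F.
Proof.
move=> c0 mF F0.
have [b0 nE0] := sqnorm_dilation R m.
have k0 : (0 < Num.sqrt c)%R by rewrite sqrtr_gt0.
have nE x : sqnorm (affine_tuple (Num.sqrt c) b0 x) = (c * sqnorm x)%R.
  by rewrite nE0 sqr_sqrtr// ltW.
have mG : measurable_fun setT (fun x => F (sqnorm x) * (radial_weight x)%:E).
  apply: emeasurable_funM; first exact: (measurableT_comp mF (@measurable_sqnorm R m)).
  by apply/measurable_EFinP; exact: measurable_radial_weight.
have G0 x : 0 <= F (sqnorm x) * (radial_weight x)%:E.
  by rewrite mule_ge0// lee_fin radial_weight_ge0.
rewrite /radial_mellin -[RHS](ge0_integral_affine_tuple b0 k0 mG G0).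
rewrite -ge0_integralZl//; last first.
  exact: (measurableT_comp mG (@measurable_affine_tuple R m _ _)).
apply: eq_integral => x _; rewrite nE muleCA -EFinM; congr (_ * _%:E).
rewrite /radial_weight nE powRM ?sqnorm_ge0 ?(ltW c0)// mulrA.
suff -> : (Num.sqrt c ^+ m * c `^ (- (m%:R / 2)) = 1)%R by rewrite mul1r.
rewrite -powR_mulrn ?sqrtr_ge0// -powR12_sqrt ?(ltW c0)// -powRrM mulrC -powRD; last first.
  by rewrite (gt_eqF c0) implybT.
by rewrite mulrC addNr powRr0.
Qed.

(* Evaluate the double integral of F(|x|^2) G(u |x|^2) in both orders, using the
   scale invariance of each of the two measures. *)
Lemma radial_mellin_mul F G :
  measurable_fun setT F -> measurable_fun setT G ->
  (forall u, 0 <= F u) -> (forall u, 0 <= G u) -> F 0%R = 0 -> G 0%R = 0 ->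
  radial_mellin F * mellin G =
  radial_mellin G * mellin (fun u => if (0 < u)%R then F (u `^ (-1))%R else 0).
Proof.
move=> mF mG F0 G0 F00 G00.
have ms := @measurable_sqnorm R m.
have mr := measurable_radial_weight.
have mi := measurable_inv_weight.
have mGu : measurable_fun setT (fun u => G u * (inv_weight u)%:E).
  by apply: emeasurable_funM => //; exact/measurable_EFinP.
have m1 c : measurable_fun setT (fun u => c * u)%R by exact: mulrl_measurable.
have minv : measurable_fun setT (fun u : R => u `^ (-1))%R by exact: measurable_powR.
pose Fi u : \bar R := if (0 < u)%R then F (u `^ (-1))%R else 0.
have mFi : measurable_fun setT Fi.
  apply: measurable_fun_ifT => //; first exact: measurable_fun_ltr.
  exact: (measurableT_comp mF minv).
have Fi0 u : 0 <= Fi u by rewrite /Fi; case: ifPn.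
have mellin_ge0 H : (forall u, 0 <= H u) -> 0 <= mellin H.
  by move=> H0; apply: integral_ge0 => u _; rewrite mule_ge0// lee_fin inv_weight_ge0.
pose K (z : Rm * R) := F (sqnorm z.1) * (radial_weight z.1)%:E *
  (G (z.2 * sqnorm z.1)%R * (inv_weight z.2)%:E).
have ms1 : measurable_fun setT (fun z : Rm * R => sqnorm z.1).
  exact: (measurableT_comp ms measurable_fst).
have mK : measurable_fun setT K.
  apply: emeasurable_funM; apply: emeasurable_funM.
  - exact: (measurableT_comp mF ms1).
  - by apply/measurable_EFinP; exact: (measurableT_comp mr measurable_fst).
  - by apply: (measurableT_comp mG); apply: measurable_funM => //; exact: measurable_snd.
  - by apply/measurable_EFinP; exact: (measurableT_comp mi measurable_snd).
have K0 z : 0 <= K z.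
  by rewrite /K !mule_ge0// lee_fin ?radial_weight_ge0 ?inv_weight_ge0.
have := fubini_tonelli (m1 := borel_measure_Rm R m) (m2 := leb) K mK K0.
have -> : \int[borel_measure_Rm R m]_x \int[leb]_u K (x, u) =
    radial_mellin F * mellin G.
  rewrite /radial_mellin -ge0_integralZr//; last 3 first.
  - apply: emeasurable_funM; first exact: (measurableT_comp mF ms).
    exact/measurable_EFinP.
  - by move=> x _; rewrite mule_ge0// lee_fin radial_weight_ge0.
  - exact: mellin_ge0.
  apply: eq_integral => x _; rewrite /K/=.
  (* The invariance of du / u applies only to a positive factor; at the origin both sides vanish
     because F(0) = 0. *)
  have [s0|s0] := eqVneq (sqnorm x) 0%R.
    rewrite s0 F00 !mul0e integral0_eq// => u _.
    by rewrite !mul0e.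
  have sp : (0 < sqnorm x)%R by rewrite lt0r s0 sqnorm_ge0.
  rewrite ge0_integralZl//; last 3 first.
  - apply: emeasurable_funM; last exact/measurable_EFinP.
    by apply: (measurableT_comp mG); exact: mulrr_measurable.
  - by move=> u _; rewrite mule_ge0// lee_fin inv_weight_ge0.
  - by rewrite mule_ge0// lee_fin radial_weight_ge0.
  congr (_ * _); rewrite -(mellin_scale sp mG G0); apply: eq_integral => u _.
  by rewrite mulrC.
move=> ->; rewrite -/Fi.
have -> : \int[leb]_u \int[borel_measure_Rm R m]_x K (x, u) =
    \int[leb]_u \int[borel_measure_Rm R m]_x
       (G (sqnorm x) * (radial_weight x)%:E *
         (Fi (u * (sqnorm x) `^ (-1))%R * (inv_weight u)%:E)).
  apply: eq_integral => u _.
  have [u0|u0] := ltP 0%R u; last first.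
    by rewrite !integral0_eq// => x _; rewrite /K /inv_weight ltNge u0 /= !mule0.
  (* For fixed u > 0 the integrand involves [H] at u |x|^2; scale invariance replaces this by [H] at
     |x|^2, which moves [u] from [G] to [F]. *)
  pose H v : \bar R := F (u^-1 * v)%R * G v * (inv_weight u)%:E.
  have mH : measurable_fun setT H.
    apply: emeasurable_funM => //; apply: emeasurable_funM => //.
    exact: (measurableT_comp mF (m1 _)).
  have H0 v : 0 <= H v by rewrite !mule_ge0// lee_fin inv_weight_ge0.
  transitivity (radial_mellin (fun v => H (u * v)%R)).
    apply: eq_integral => x _; rewrite /K /H/= mulKf ?gt_eqF//.
    by rewrite -!muleA; congr (_ * _); rewrite muleC -!muleA.
  rewrite radial_mellin_scale//; apply: eq_integral => x _; rewrite /H /Fi.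
  have [s0|s0] := eqVneq (sqnorm x) 0%R.
    by rewrite s0 G00 !(mule0, mul0e).
  have sp : (0 < sqnorm x)%R by rewrite lt0r s0 sqnorm_ge0.
  rewrite mulr_gt0 ?powR_gt0// !powR_inv1 ?mulr_ge0 ?invr_ge0 ?ltW// invfM invrK.
  rewrite (muleC (F _)) -!muleA; congr (_ * _); rewrite [RHS]muleCA.
  by congr (_ * _); exact: muleC.
pose K' (z : Rm * R) := G (sqnorm z.1) * (radial_weight z.1)%:E *
  (Fi (z.2 * (sqnorm z.1) `^ (-1))%R * (inv_weight z.2)%:E).
have mK' : measurable_fun setT K'.
  apply: emeasurable_funM; apply: emeasurable_funM.
  - exact: (measurableT_comp mG ms1).
  - by apply/measurable_EFinP; exact: (measurableT_comp mr measurable_fst).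
  - apply: (measurableT_comp mFi); apply: measurable_funM; first exact: measurable_snd.
    exact: (measurableT_comp minv ms1).
  - by apply/measurable_EFinP; exact: (measurableT_comp mi measurable_snd).
have K'0 z : 0 <= K' z.
  by rewrite /K' !mule_ge0// lee_fin ?radial_weight_ge0 ?inv_weight_ge0.
rewrite -(fubini_tonelli (m1 := borel_measure_Rm R m) (m2 := leb) K' mK' K'0).
rewrite /radial_mellin -ge0_integralZr//; last 3 first.
- apply: emeasurable_funM; first exact: (measurableT_comp mG ms).
  exact/measurable_EFinP.
- by move=> x _; rewrite mule_ge0// lee_fin radial_weight_ge0.
- exact: mellin_ge0.
apply: eq_integral => x _; rewrite /K'/=.
have [s0|s0] := eqVneq (sqnorm x) 0%R.
  rewrite s0 G00 !mul0e integral0_eq// => u _.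
  by rewrite !mul0e.
have sp : (0 < sqnorm x `^ (-1))%R by rewrite powR_gt0// lt0r s0 sqnorm_ge0.
have mFx : measurable_fun setT
    (fun u => Fi (u * (sqnorm x `^ (-1)))%R * (inv_weight u)%:E).
  apply: emeasurable_funM; last exact/measurable_EFinP.
  by apply: (measurableT_comp mFi); exact: mulrr_measurable.
have Fx0 u : 0 <= Fi (u * (sqnorm x `^ (-1)))%R * (inv_weight u)%:E.
  by rewrite mule_ge0// lee_fin inv_weight_ge0.
have c0 : 0 <= G (sqnorm x) * (radial_weight x)%:E.
  by rewrite mule_ge0// lee_fin radial_weight_ge0.
rewrite (ge0_integralZl leb measurableT mFx (fun u _ => Fx0 u) c0).
congr (_ * _); transitivity (mellin (fun u => Fi (sqnorm x `^ (-1) * u)%R)).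
  by apply: eq_integral => u _; rewrite mulrC.
exact: mellin_scale.
Qed.

End radial.

(** * Mellin transforms and the Gamma integral *)

Section gamma_mellin.
Local Open Scope ereal_scope.
Context (R : realType).
Local Notation leb := (@lebesgue_measure R).

(** For a = m/2, its value at |x|^2 times |x|^-m is exp(- |x|^2 / 2) off the origin, the Gaussian
    density up to its constant; raising [a] by 1/2 inserts one factor |x|. *)
Definition gamma_fun (a u : R) : R := (u `^ a * expR (- u / 2))%R.

Lemma gamma_fun_ge0 a u : (0 <= gamma_fun a u)%R.
Proof. by rewrite mulr_ge0 ?powR_ge0 ?expR_ge0. Qed.

Lemma measurable_gamma_fun a : measurable_fun setT (gamma_fun a).
Proof.
apply: measurable_funM; first exact: measurable_powR.
apply: measurableT_comp => //; apply: measurable_funM => //.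

Qed.

(** The substitution u = 2t. The right-hand integral stays in the extended reals because its
    finiteness is not yet established. *)
Lemma mellin_gamma_fun a : mellin (EFin \o gamma_fun a) =
  (2 `^ a)%:E *
  \int[leb]_(t in `]0%R, +oo[) (t `^ (a - 1) * expR (- t))%:E.
Proof.
have mg : measurable_fun setT (EFin \o gamma_fun a).
  by apply/measurable_EFinP; exact: measurable_gamma_fun.
have g0 u : 0 <= (EFin \o gamma_fun a) u by rewrite lee_fin gamma_fun_ge0.
rewrite -(mellin_scale (c := 2) _ mg g0)//.
have mt : measurable_fun setT (fun t : R => (t `^ (a - 1) * expR (- t))%R).
  apply: measurable_funM; first exact: measurable_powR.
  by apply: measurableT_comp => //; exact: oppr_measurable.
rewrite -ge0_integralZl//; last 2 first.
- by apply: measurable_funTS; exact/measurable_EFinP.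
- by move=> u _; rewrite lee_fin mulr_ge0 ?powR_ge0 ?expR_ge0.
rewrite [RHS]integral_mkcond; apply: eq_integral => u _.
rewrite patchE mem_setE/= in_itv/= andbT /inv_weight.
case: ifPn => u0; last by rewrite mule0.
rewrite -!EFinM; congr EFin; rewrite /gamma_fun powRM ?ltW// powRD; last first.
  by rewrite (gt_eqF u0) implybT.
by rewrite (_ : - (2 * u) / 2 = - u)%R; [ring|field].
Qed.

(** Inversion carries [[1, 2]] to [[1/2, 1]], where 1/u lies between 1 and 2. This is the known
    quantity from which finiteness is later deduced. *)
Lemma mellin_indic12 :
  0 < mellin (fun u : R => if (0 < u)%R then (\1_`[1%R, 2%R] (u `^ (-1)))%:E else 0) < +oo.
Proof.
have E (u : R) : (if (0 < u)%R then (\1_`[1%R, 2%R] (u `^ (-1)))%:E else 0) =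
    (\1_`[2^-1%R, 1%R] u : R)%:E.
  case: ifPn => u0.
    rewrite !indicE !mem_setE !in_itv/= (powR_inv1 (ltW u0)) invf_ge1// andbC.
    by rewrite -[X in (_ <= X)%R && _]invrK lef_pV2 ?posrE ?invr_gt0.
  rewrite indicE mem_setE in_itv/= (_ : (2^-1 <= u)%R = false)//.
  by apply/negbTE; rewrite -ltNge; move: u0; rewrite -leNgt => u0; lra.
have mw : measurable_fun (`[2^-1%R, 1%R]%classic : set R) (fun u : R => (inv_weight u)%:E).
  by apply/measurable_EFinP; apply: measurable_funTS; exact: measurable_inv_weight.
have lebE : leb (`[(2^-1)%R, 1%R]%classic : set R) = (2^-1)%:E.
  rewrite lebesgue_measure_itv/= lte_fin ifT -?EFinB; last by lra.
  by congr EFin; lra.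
have w12 u : (`[2^-1%R, 1%R]%classic : set R) u -> (1 <= inv_weight u <= 2)%R.
  rewrite /= in_itv/= => /andP[u1 u2]; have u0 : (0 < u)%R by lra.
  rewrite /inv_weight u0 (powR_inv1 (ltW u0)); apply/andP; split.
    by rewrite invf_ge1.
  by rewrite -[X in (_ <= X)%R]invrK lef_pV2 ?posrE ?invr_gt0.
have -> : mellin (fun u : R => if (0 < u)%R then (\1_`[1%R, 2%R] (u `^ (-1)))%:E else 0)
    = \int[leb]_(u in `[2^-1%R, 1%R]) (inv_weight u)%:E.
  rewrite [RHS]integral_mkcond; apply: eq_integral => u _.
  by rewrite epatch_indic E muleC.
apply/andP; split.
  apply: (@lt_le_trans _ _ (\int[leb]_(u in `[2^-1%R, 1%R]) (1%R)%:E)).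
    by rewrite integral_cst// mul1e [X in _ < X]lebE lte_fin invr_gt0.
  by apply: ge0_le_integral => //= u /w12/andP[]; rewrite lee_fin.
apply: (@le_lt_trans _ _ (\int[leb]_(u in `[2^-1%R, 1%R]) (2%R)%:E)).
  apply: ge0_le_integral => //= u u12; rewrite lee_fin ?inv_weight_ge0//.
  by have /andP[] := w12 u u12.
by rewrite integral_cst// [X in _ * X]lebE -EFinM ltry.
Qed.

End gamma_mellin.

(** * Radial integrals of the Gaussian *)

Section chi.
Local Open Scope ereal_scope.
Context (R : realType) (m : nat) (m0 : (0 < m)%N).
Local Notation leb := (borel_measure_Rm R m).
Local Notation N := (std_gaussian R m).
Local Notation Rm := (m.-tuple (measurableTypeR R)).
Implicit Types x z : Rm.

Let C : R := (normal_peak 1 ^+ m)%R.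

Let C_gt0 : (0 < C)%R.
Proof. by rewrite exprn_gt0// normal_peak_gt0. Qed.

Lemma measurable_sqnorm_eq0 : measurable [set x : Rm | sqnorm x = 0%R].
Proof.
rewrite (_ : [set x | _] = setT `&` (@sqnorm R m) @^-1` [set 0%R]); last by rewrite setTI.
exact: (@measurable_sqnorm R m measurableT [set 0%R] (measurable_set1 (0 : R))).
Qed.

(** The dilation by 2 preserves this set, so its measure is unchanged by the factor 2^m. The measure
    is finite because the Gaussian density is constant on the set, and m > 0 then forces it to be
    0. *)
Lemma sqnorm_eq0_null : leb [set x | sqnorm x = 0%R] = 0.
Proof.
set A := [set x | _].
have mA : measurable A.
  exact: measurable_sqnorm_eq0.
have [b0 nE] := sqnorm_dilation R m.
have mi : measurable_fun setT (fun x : Rm => (\1_A x : R)%:E).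
  by apply/measurable_EFinP; exact: measurable_indic.
have i0 x : 0 <= (\1_A x : R)%:E by rewrite lee_fin.
have scaleA : (2 ^+ m)%:E * leb A = leb A.
  have iA : \int[leb]_x (\1_A x : R)%:E = leb A by rewrite integral_indic// setIT.
  rewrite -{2}iA -(ge0_integral_affine_tuple b0 (ltr0n R 2) mi i0); congr (_ * _).
  rewrite -iA; apply: eq_integral => x _.
  rewrite !indicE; congr (_%:R)%:E; congr nat_of_bool.
  apply/idP/idP => /set_mem; rewrite /A/= => h; apply/mem_set => /=.
    by rewrite nE h mulr0.
  by move: h; rewrite nE => /eqP; rewrite mulf_eq0 expf_eq0/= pnatr_eq0/= => /eqP.
have CA : C%:E * leb A <= 1.
  rewrite -(integral_gauss_density R m) -integral_cst//.
  apply: (@le_trans _ _ (\int[leb]_(x in A) (gauss_density x)%:E)).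
    rewrite le_eqVlt; apply/orP; left; apply/eqP; apply: eq_integral => x.
    by rewrite inE /A/= /gauss_density => ->; rewrite oppr0 mul0r expR0 mulr1.
  apply: ge0_subset_integral => //.
    by apply/measurable_EFinP; exact: measurable_gauss_density.
  by move=> x _; rewrite lee_fin gauss_density_ge0.
have fA : leb A \is a fin_num.
  rewrite ge0_fin_numE ?measure_ge0//; move: CA.
  case: (leb A) => [r|//|//]; first by rewrite ltry.
  by rewrite mulry gtr0_sg// mul1e leNgt ltry.
move: scaleA; rewrite -(fineK fA) -EFinM => -[h].
have /eqP : ((2 ^+ m - 1) * fine (leb A) = 0)%R by rewrite mulrBl h mul1r subrr.
rewrite mulf_eq0 subr_eq0 gt_eqF/= => [/eqP->//|].
by rewrite exprn_egt1 ?ltr1n// -lt0n.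
Qed.

Let gamma_ge0 a (u : R) : 0 <= (EFin \o gamma_fun a) u.
Proof. by rewrite lee_fin gamma_fun_ge0. Qed.

Let measurable_gammaE a : measurable_fun setT (EFin \o gamma_fun a : R -> \bar R).
Proof. by apply/measurable_EFinP; exact: measurable_gamma_fun. Qed.

Let measurable_radial a : measurable_fun setT
  (fun x : Rm => (gamma_fun a (sqnorm x))%:E * (radial_weight x)%:E).
Proof.
apply: emeasurable_funM; last by
  apply/measurable_EFinP; exact: measurable_radial_weight.
exact: (measurableT_comp (measurable_gammaE a) (@measurable_sqnorm R m)).
Qed.

Let radial_mellin_ge0 F : (forall u, 0 <= F u) -> 0 <= @radial_mellin R m F.
Proof.
by move=> F0; apply: integral_ge0 => x _; rewrite mule_ge0// lee_fin radial_weight_ge0.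
Qed.

Let mellin_ge0 F : (forall u, 0 <= F u) -> 0 <= @mellin R F.
Proof.
by move=> F0; apply: integral_ge0 => x _; rewrite mule_ge0// lee_fin inv_weight_ge0.
Qed.

(** The integrands agree only almost everywhere: at the origin the left one is 0, as [powR] sends 0
    to 0 for a nonzero exponent. *)
Lemma radial_mellin_gamma_half :
  radial_mellin m (EFin \o gamma_fun (m%:R / 2)) = (C^-1)%:E.
Proof.
transitivity (\int[leb]_x ((C^-1)%:E * (gauss_density x)%:E)); last first.
  rewrite ge0_integralZl//.
  - by rewrite integral_gauss_density mule1.
  - by apply/measurable_EFinP; exact: measurable_gauss_density.
  - by move=> x _; rewrite lee_fin gauss_density_ge0.
  - by rewrite lee_fin invr_ge0 ltW.
apply: ge0_ae_eq_integral => //.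
- exact: measurable_radial.
- apply: emeasurable_funM => //.
  by apply/measurable_EFinP; exact: measurable_gauss_density.
- by move=> x _; rewrite mule_ge0// lee_fin radial_weight_ge0.
- by move=> x _; rewrite mule_ge0// lee_fin ?gauss_density_ge0// invr_ge0 ltW.
- exists [set x | sqnorm x = 0%R]; split => //=.
  + exact: measurable_sqnorm_eq0.
  + exact: sqnorm_eq0_null.
  + move=> x /=; apply: contra_notP => /eqP s0 _; rewrite -!EFinM; congr EFin.
    rewrite /gauss_density mulKf ?gt_eqF// /gamma_fun /radial_weight mulrAC -powRD.
      by rewrite subrr powRr0 mul1r.
    by rewrite s0 implybT.
Qed.

Lemma radial_mellin_gamma_half1 :
  radial_mellin m (EFin \o gamma_fun (m%:R / 2 + 2^-1)) =
  (C^-1)%:E * \int[N]_z (Num.sqrt (sqnorm z))%:E.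
Proof.
have ms : measurable_fun setT (fun z : Rm => (Num.sqrt (sqnorm z))%:E).
  by apply/measurable_EFinP; exact: measurable_norm.
rewrite ge0_integral_std_gaussian//.
have mg : measurable_fun setT (fun z : Rm => (gauss_density z)%:E).
  by apply/measurable_EFinP; exact: measurable_gauss_density.
rewrite -ge0_integralZl//; last 3 first.
- exact: emeasurable_funM.
- by move=> z _; rewrite mule_ge0// lee_fin ?gauss_density_ge0 ?sqrtr_ge0.
- by rewrite lee_fin invr_ge0 ltW.
apply: eq_integral => z _; rewrite -!EFinM; congr EFin.
rewrite [RHS]mulrCA /gauss_density mulKf ?gt_eqF// /gamma_fun /radial_weight.
(* The extra factor |z| makes both sides vanish at the origin, so the equality is pointwise
   everywhere. *)
have [s0|s0] := eqVneq (sqnorm z) 0%R.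
  by rewrite s0 sqrtr0 powR0 ?mul0r// gt_eqF// addr_gt0// ?invr_gt0// divr_gt0// ltr0n.
rewrite mulrAC -powRD; last by rewrite s0 implybT.
by rewrite addrC addKr powR12_sqrt ?sqnorm_ge0.
Qed.

(** With the indicator of [[1, 2]] as [F], the comparison reads L J = K / C with [K] positive and
    finite, so the unknown [J] can be neither 0 nor infinite. *)
Lemma mellin_gamma_half_fin :
  0 < mellin (EFin \o gamma_fun (m%:R / 2 : R)) < +oo.
Proof.
have mh0 : (m%:R / 2 : R)%R != 0%R.
  by rewrite mulf_neq0 ?invr_neq0 ?pnatr_eq0 -?lt0n ?gt_eqF.
have mF : measurable_fun setT (fun u : R => (\1_`[1%R, 2%R] u : R)%:E).
  by apply/measurable_EFinP; exact: measurable_indic.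
have F0 (u : R) : 0 <= (\1_`[1%R, 2%R] u : R)%:E by rewrite lee_fin.
have F00 : (\1_`[1%R, 2%R] (0 : R) : R)%:E = 0.
  by rewrite indicE mem_setE in_itv/= ler10.
have G00 : (EFin \o gamma_fun (m%:R / 2 : R)) 0%R = 0.
  by rewrite /= /gamma_fun powR0// mul0r.
have := radial_mellin_mul m mF (measurable_gammaE (m%:R / 2)) F0 (gamma_ge0 _) F00 G00.
rewrite radial_mellin_gamma_half.
have /andP[] := mellin_indic12 R.
set K := mellin (fun u => if _ then _ else _).
have := radial_mellin_ge0 F0; have := mellin_ge0 (gamma_ge0 (m%:R / 2)).
set L := radial_mellin _ _; set J := mellin _ => J0 L0 K0 Koo LJ.
have LJ0 : 0 < L * J by rewrite LJ mule_gt0// lte_fin invr_gt0.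
have LJoo : L * J < +oo by rewrite LJ lte_mul_pinfty ?lee_fin ?invr_ge0 ?ltW.
have Jn0 : J != 0 by apply: contraTneq LJ0 => ->; rewrite mule0 ltxx.
have Ln0 : L != 0 by apply: contraTneq LJ0 => ->; rewrite mul0e ltxx.
rewrite lt0e Jn0 J0/= ltey; apply: contraTneq LJoo => ->.
by rewrite gt0_muley ?lt0e ?Ln0// ltxx.
Qed.

End chi.

(** The derivative of the difference is (exp(c) - 1)^2 / exp(c). At w = ln v the inequality bounds
    ln v by (v - 1/v) / 2, as the tail estimate requires. *)
Lemma ler_expR_sub_expRN (R : realType) (w : R) : 0 <= w ->
  w *+ 2 <= expR w - expR (- w).
Proof.
rewrite le_eqVlt => /predU1P[<-|w0]; first by rewrite mul0rn oppr0 subrr.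
pose f (x : R) : R := expR x - expR (- x) - x *+ 2.
pose df (x : R) : R := expR x + expR (- x) - 2.
have fdf (x : R) : is_derive x (1 : R) f (df x).
  by apply: is_derive_eq; rewrite /df; ring.
have cf : {within `[0, w], continuous f}.
  apply: derivable_within_continuous => x _.
  exact: (@ex_derive _ _ _ _ _ _ _ (fdf x)).
have [c _] := MVT w0 (fun x _ => fdf x) cf.
have f0 : f 0 = 0 by rewrite /f oppr0 mul0rn !subrr.
move=> fE; have {}fE : f w = df c * w by move: fE; rewrite f0; lra.
rewrite -subr_ge0 -/(f w) fE mulr_ge0 ?(ltW w0)// /df.
have e0 : 0 < expR c by exact: expR_gt0.
rewrite expRN -(pmulr_rge0 _ e0) mulrBr mulrDr mulfV ?gt_eqF//.
by have := sqr_ge0 (expR c - 1); nra.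
Qed.

(** * Mean and second moment of the norm *)

Section chi_moments.
Local Open Scope ereal_scope.
Context (R : realType) (m : nat) (m0 : (0 < m)%N).
Local Notation N := (std_gaussian R m).
Local Notation Rm := (m.-tuple (measurableTypeR R)).

Let measurable_sqnormE : measurable_fun setT (fun z : Rm => (sqnorm z)%:E).
Proof. by apply/measurable_EFinP; exact: measurable_sqnorm. Qed.

Let measurable_exp_sqnorm (t : R) :
  measurable_fun setT (fun z : Rm => (expR (t * sqnorm z))%:E).
Proof.
apply/measurable_EFinP/measurableT_comp => //; apply: measurable_funM => //.
exact: measurable_sqnorm.
Qed.

Lemma gauss_mgf_sqnorm_expR (w : R) :
  \int[N]_z (expR ((1 - expR (- w) ^+ 2) / 2 * sqnorm z))%:E =
  (expR (m%:R * w))%:E.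
Proof.
rewrite gauss_mgf_sqnorm ?expR_gt0//; congr EFin.
by rewrite -expRM_natl -expRN mulrN opprK.
Qed.

(** Integrating 1 + t |z|^2 <= exp(t |z|^2) gives t E|Z|^2 <= exp(m w) - 1 <= m w exp(m w), while t
    >= w exp(-2w). The bound by [m] is the limit as [w] tends to 0. *)
Let second_moment_le_expR (w : R) : (0 < w)%R ->
  \int[N]_z (sqnorm z)%:E <= (m%:R * expR ((m%:R + 2) * w))%:E.
Proof.
move=> w0; set M := \int[N]_z _.
have e2 : (expR (- w) ^+ 2 = expR (- (2 * w)))%R by rewrite -expRM_natl mulrN.
have tge : (w * expR (- (2 * w)) <= (1 - expR (- w) ^+ 2) / 2)%R.
  rewrite e2; have := expR_ge1Dx (2 * w); rewrite expRN.
  have := expR_gt0 (2 * w); set E := expR _ => E0 E1.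
  rewrite ler_pdivlMr// -(ler_pM2r E0) mulrBl mulVf ?gt_eqF// mul1r.
  by rewrite mulrAC divfK ?gt_eqF//; lra.
have t0 : (0 < (1 - expR (- w) ^+ 2) / 2)%R.
  by apply: lt_le_trans tge; rewrite mulr_gt0// expR_gt0.
set t : R := ((1 - expR (- w) ^+ 2) / 2)%R in tge t0.
have : t%:E * M + 1 <= (expR (m%:R * w))%:E.
  rewrite -gauss_mgf_sqnorm_expR -/t.
  have one : \int[N]_z (1%E : \bar R) = 1.
    by rewrite integral_cst// mul1e; exact: std_gaussian_setT.
  rewrite -one -ge0_integralZl//; last 2 first.
  - by move=> z _; rewrite lee_fin sqnorm_ge0.
  - by rewrite lee_fin ltW.
  rewrite -ge0_integralD//; last 2 first.
  - by move=> z _; rewrite mule_ge0// lee_fin ?sqnorm_ge0// ltW.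
  - by apply: emeasurable_funM.
  apply: ge0_le_integral => //.
  - by move=> z _; rewrite adde_ge0// mule_ge0// lee_fin ?sqnorm_ge0// ltW.
  - by apply: emeasurable_funD => //; exact: emeasurable_funM.
  - by move=> z _; rewrite -EFinM -EFinD lee_fin addrC expR_ge1Dx.
have M0 : 0 <= M by apply: integral_ge0 => z _; rewrite lee_fin sqnorm_ge0.
case: M M0 => [r|_|//]; last by rewrite gt0_muley ?lte_fin.
rewrite -EFinM -EFinD !lee_fin => r0 H.
have H2 : (expR (m%:R * w) <= 1 + m%:R * w * expR (m%:R * w))%R.
  have := expR_ge1Dx (- (m%:R * w)); rewrite expRN.
  have := expR_gt0 (m%:R * w); set E := expR _ => E0.
  rewrite -(ler_pM2l E0) mulfV ?gt_eqF//; lra.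
have H3 : (w * expR (- (2 * w)) * r <= m%:R * w * expR (m%:R * w))%R.
  by apply: (le_trans (ler_wpM2r r0 tge)); lra.
have {}H3 : (expR (- (2 * w)) * r <= m%:R * expR (m%:R * w))%R.
  by rewrite -(ler_pM2l w0); move: H3; lra.
have E0 := expR_gt0 (2 * w).
rewrite mulrDl expRD mulrA -(ler_pM2l (expR_gt0 (- (2 * w)))).
by rewrite mulrCA -expRD addNr expR0 mulr1.
Qed.

Lemma gauss_second_moment_le : \int[N]_z (sqnorm z)%:E <= m%:R%:E.
Proof.
have := second_moment_le_expR.
set M := \int[N]_z _ => H.
have M0 : 0 <= M by apply: integral_ge0 => z _; rewrite lee_fin sqnorm_ge0.
case: M M0 H => [r|_ /(_ _ ltr01)|//]; last by rewrite leye_eq.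
rewrite !lee_fin => r0 H; rewrite leNgt; apply/negP => rm.
have mp : (0 < m%:R :> R)%R by rewrite ltr0n.
have rm1 : (1 < r / m%:R)%R by rewrite ltr_pdivlMr// mul1r.
have L0 : (0 < ln (r / m%:R))%R by rewrite ln_gt0.
(* If the moment [r] exceeded [m], this [w] would bound it by m sqrt(r / m) < r. *)
pose w := (ln (r / m%:R) / (2 * (m%:R + 2)))%R.
have m2 : (0 < m%:R + 2 :> R)%R by rewrite addr_gt0.
have w0 : (0 < w)%R by rewrite divr_gt0// mulr_gt0.
have := H w w0; rewrite lee_fin leNgt => /negP; apply.
have -> : ((m%:R + 2) * w = ln (r / m%:R) / 2)%R.
  by rewrite /w; field; rewrite gt_eqF.
rewrite -ltr_pdivlMl// [ltRHS]mulrC -[ltRHS]lnK ?posrE ?(lt_trans ltr01)//.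
by rewrite ltr_expR ltr_pdivrMr// ltr_pMr// ltr1n.
Qed.

(** AM-GM in place of Cauchy-Schwarz: |z| <= |z|^2 / (2s) + s/2, with s = sqrt(m) chosen so that the
    second moment bound yields exactly [s]. *)
Lemma gauss_norm_le : \int[N]_z (Num.sqrt (sqnorm z))%:E <= (Num.sqrt m%:R)%:E.
Proof.
have mp : (0 < m%:R :> R)%R by rewrite ltr0n.
have s0 : (0 < Num.sqrt (m%:R : R))%R by rewrite sqrtr_gt0.
set s : R := Num.sqrt m%:R in s0 *.
have one : \int[N]_z ((s / 2)%:E : \bar R) = (s / 2)%:E.
  rewrite integral_cst//=; transitivity ((s / 2)%:E * 1); last by rewrite mule1.
  by congr (_ * _); exact: std_gaussian_setT.
apply: (@le_trans _ _ (\int[N]_z (((2 * s)^-1)%:E * (sqnorm z)%:E + (s / 2)%:E))).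
  apply: ge0_le_integral => //.
  - by apply/measurable_EFinP; exact: measurable_norm.
  - by apply: emeasurable_funD => //; exact: emeasurable_funM.
  - move=> z _; rewrite -EFinM -EFinD lee_fin.
    have q0 := sqrtr_ge0 (sqnorm z); rewrite -{2}(sqr_sqrtr (sqnorm_ge0 z)).
    set q := Num.sqrt (sqnorm z) in q0 *.
    have i0 : (0 < (2 * s)^-1)%R by rewrite invr_gt0 mulr_gt0.
    rewrite -subr_ge0 (_ : _ - _ = (2 * s)^-1 * (q - s) ^+ 2)%R.
      by rewrite mulr_ge0 ?sqr_ge0// ltW.
    by field; rewrite gt_eqF.
have i0 : (0 <= (2 * s)^-1)%R by rewrite invr_ge0 mulr_ge0// ltW.
rewrite ge0_integralD//; last 3 first.
- by move=> z _; rewrite mule_ge0// lee_fin ?sqnorm_ge0.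
- by apply: emeasurable_funM.
- by move=> z _; rewrite lee_fin divr_ge0// ltW.
rewrite one ge0_integralZl//; last first.
  by move=> z _; rewrite lee_fin sqnorm_ge0.
apply: (@le_trans _ _ (((2 * s)^-1)%:E * (m%:R)%:E + (s / 2)%:E)).
  by rewrite leeD2r// lee_wpmul2l// gauss_second_moment_le.
rewrite -EFinM -EFinD lee_fin.
have -> : (m%:R = s ^+ 2 :> R)%R by rewrite sqr_sqrtr// ltW.
by rewrite le_eqVlt; apply/orP; left; apply/eqP; field; rewrite gt_eqF.
Qed.

(* Taking F = gamma_fun (m / 2) in radial_mellin_mul identifies the constant of
   proportionality between the radial and the one-dimensional integrals. *)
Lemma mellin_gamma_norm :
  mellin (EFin \o gamma_fun (m%:R / 2 + 2^-1 : R)) =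
  \int[N]_z (Num.sqrt (sqnorm z))%:E * mellin (EFin \o gamma_fun (m%:R / 2 : R)).
Proof.
have mp : (0 < m%:R / 2 :> R)%R by rewrite divr_gt0 ?ltr0n.
have g0 a (u : R) : 0 <= (EFin \o gamma_fun a) u by rewrite lee_fin gamma_fun_ge0.
have mg a : measurable_fun setT (EFin \o gamma_fun a : R -> \bar R).
  by apply/measurable_EFinP; exact: measurable_gamma_fun.
have g00 (a : R) : (0 < a)%R -> (EFin \o gamma_fun a) 0%R = 0.
  by move=> a0; rewrite /= /gamma_fun powR0 ?mul0r// gt_eqF.
have a1 : (0 < m%:R / 2 + 2^-1 :> R)%R by rewrite addr_gt0// invr_gt0.
have H a : (0 < a)%R -> _ := fun a0 => radial_mellin_mul m (mg (m%:R / 2)%R) (mg a)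
  (g0 _) (g0 _) (g00 _ mp) (g00 a a0).
have := H _ mp; have := H _ a1; rewrite radial_mellin_gamma_half//.
rewrite radial_mellin_gamma_half1//.
set C : R := (normal_peak 1 ^+ m)%R; set K := mellin (fun u => if _ then _ else _).
set J1 := mellin _; set J0 := mellin _; set e := integral _ _ _ => H1 H0.
have C0 : (0 < C)%R by rewrite exprn_gt0// normal_peak_gt0.
have CK x : C%:E * ((C^-1)%:E * x) = x by rewrite muleA -EFinM mulfV ?gt_eqF// mul1e.
(* Up to the factor [C^-1], [H0] says J0 = K and [H1] says J1 = e K. *)
by rewrite -(CK J1) H1 -muleA CK -(CK J0) H0 CK.
Qed.

Lemma gauss_norm_expectation :
  \int[N]_z (Num.sqrt (sqnorm z))%:E =
  (Num.sqrt 2 * (Gamma (m%:R / 2 + 2^-1) / Gamma (m%:R / 2)))%:E.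
Proof.
have := mellin_gamma_norm; have := gauss_norm_le.
have : 0 <= \int[N]_z (Num.sqrt (sqnorm z))%:E.
  by apply: integral_ge0 => z _; rewrite lee_fin sqrtr_ge0.
set e := integral _ _ _ => e0 em.
have efin : e \is a fin_num by rewrite ge0_fin_numE// (le_lt_trans em)// ltry.
have := mellin_gamma_half_fin R m0; rewrite !mellin_gamma_fun /Gamma /Rintegral.
set G0 := integral _ _ _; set G1 := integral _ _ _.
have p2 a : (0 < 2 `^ a :> R)%R by rewrite powR_gt0.
have G00 : 0 <= G0.
  by apply: integral_ge0 => u _; rewrite lee_fin mulr_ge0 ?powR_ge0 ?expR_ge0.
have G10 : 0 <= G1.
  by apply: integral_ge0 => u _; rewrite lee_fin mulr_ge0 ?powR_ge0 ?expR_ge0.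
(* [Gamma] reads these integrals through [fine], which would send [+oo] to 0. The one at m/2 is
   finite by [mellin_gamma_half_fin], the other because it is proportional to it. *)
case: G0 G00 => [g0| |//] G00; last by rewrite gt0_muley ?lte_fin//= ?ltxx ?andbF.
rewrite -EFinM !lte_fin pmulr_rgt0// => /andP[g0p _].
rewrite -(fineK efin) -!EFinM.
case: G1 G10 => [g1| |//] G10; last by rewrite gt0_muley ?lte_fin.
rewrite -EFinM => -[H] /=; congr EFin.
have p2e := p2 (m%:R / 2)%R.
move: H; rewrite powRD ?pnatr_eq0 ?implybT// powR12_sqrt// => H.
have {}H : (Num.sqrt 2 * g1 = fine e * g0)%R.
  apply: (@mulfI _ (2 `^ (m%:R / 2))%R); first by rewrite gt_eqF.
  by rewrite mulrA H; ring.
by rewrite mulrA H mulfK// gt_eqF.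
Qed.

End chi_moments.

(** * Tail of the norm *)

Section chi_tail.
Local Open Scope ereal_scope.
Context (R : realType) (m : nat) (m0 : (0 < m)%N).
Local Notation N := (std_gaussian R m).
Local Notation Rm := (m.-tuple (measurableTypeR R)).

(** Markov's inequality for exp(t |z|^2) with t = (1 - exp(-2w)) / 2. *)
Lemma gauss_chernoff (w r : R) : (0 < w)%R ->
  N [set z : Rm | (r < sqnorm z)%R] <=
  (expR (m%:R * w - (1 - expR (- w) ^+ 2) / 2 * r))%:E.
Proof.
move=> w0; set t : R := ((1 - expR (- w) ^+ 2) / 2)%R.
have t0 : (0 <= t)%R.
  rewrite divr_ge0// subr_ge0 expr_le1// ?expR_ge0//.
  by rewrite -[leRHS]expR0 ler_expR oppr_le0 ltW.
set A := [set z | _].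
have mA : measurable A.
  rewrite (_ : A = setT `&` (@sqnorm R m) @^-1` `]r, +oo[%classic).
    exact: (@measurable_sqnorm R m measurableT _ (measurable_itv `]r, +oo[)).
  by rewrite setTI; apply/seteqP; split => z; rewrite /A/= in_itv/= andbT.
have me : measurable_fun setT (fun z : Rm => (expR (t * sqnorm z))%:E).
  apply/measurable_EFinP/measurableT_comp => //; apply: measurable_funM => //.
  exact: measurable_sqnorm.
have : (expR (t * r))%:E * N A <= (expR (m%:R * w))%:E.
  rewrite -gauss_mgf_sqnorm_expR -/t -integral_cst//.
  apply: (@le_trans _ _ (\int[N]_(z in A) (expR (t * sqnorm z))%:E)).
    apply: ge0_le_integral => //.
    - by move=> z _; rewrite lee_fin expR_ge0.
    - exact: measurable_funTS.
    - by move=> z /ltW rz; rewrite lee_fin ler_expR ler_wpM2l.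
  by apply: ge0_subset_integral => // z _; rewrite lee_fin expR_ge0.
rewrite expRD expRN EFinM -lee_pdivlMl ?expR_gt0//.
by rewrite muleC.
Qed.

(* The choice 1 - 2t = sqrt m / (sqrt m + 2 sqrt x) in Chernoff's bound, with
   x = ln (1 / beta), makes the exponent equal to -x. *)
Lemma gauss_norm_tail (beta : R) : (0 < beta < 1)%R ->
  (1 - beta)%:E <= N [set z : Rm | (Num.sqrt (sqnorm z) <= eta2 beta m)%R].
Proof.
move=> /andP[b0 b1].
have mp : (0 < m%:R :> R)%R by rewrite ltr0n.
set x : R := ln (1 / beta).
have x0 : (0 < x)%R by rewrite ln_gt0// ltr_pdivlMr// mul1r.
have xE : expR (- x) = beta by rewrite expRN lnK ?div1r ?invrK// posrE invr_gt0.
pose a : R := Num.sqrt m%:R; pose y : R := Num.sqrt x.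
have a0 : (0 < a)%R by rewrite sqrtr_gt0.
have y0 : (0 < y)%R by rewrite sqrtr_gt0.
have aE : (m%:R = a ^+ 2 :> R)%R by rewrite sqr_sqrtr// ltW.
have yE : (x = y ^+ 2)%R by rewrite sqr_sqrtr// ltW.
pose r : R := (a ^+ 2 + 2 * (a * y) + 2 * y ^+ 2)%R.
have etaE : eta2 beta m = Num.sqrt r.
  by rewrite /eta2 -/x sqrtrM ?ler0n// -/a -/y /r -yE -aE.
have r0 : (0 <= r)%R.
  by rewrite /r !addr_ge0// ?mulr_ge0// ?sqr_ge0// ltW.
pose v : R := ((a + 2 * y) / a)%R.
have v1 : (1 < v)%R by rewrite ltr_pdivlMr// mul1r ltrDl mulr_gt0.
have v0 : (0 < v)%R by apply: lt_trans v1.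
pose w : R := (ln v / 2)%R.
have w0 : (0 < w)%R by rewrite divr_gt0// ln_gt0.
have ew : (expR (- w) ^+ 2 = v^-1)%R.
  rewrite -expRM_natl (_ : 2 * - w = - ln v)%R; last by rewrite /w; field.
  by rewrite expRN lnK.
(* This replaces the logarithm in [w] by a rational function of [v]; the exponent then equals -x by
   pure algebra. *)
have wv : (w <= (v - v^-1) / 4)%R.
  have := ler_expR_sub_expRN (ltW (ln_gt0 v1)).
  by rewrite expRN lnK ?posrE// /w mulr2n; lra.
have ay0 : (a + 2 * y)%R != 0%R by rewrite gt_eqF// addr_gt0// mulr_gt0.
have expo : (m%:R * w - (1 - expR (- w) ^+ 2) / 2 * r <= - x)%R.
  rewrite ew; apply: (@le_trans _ _ (m%:R * ((v - v^-1) / 4) - (1 - v^-1) / 2 * r)%R).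
    by rewrite lerB// ler_wpM2l// ltW.
  rewrite le_eqVlt; apply/orP; left; apply/eqP; rewrite aE yE /v /r.
  by field; rewrite ay0 gt_eqF.
set A := [set z | _].
have mA : measurable A.
  rewrite (_ : A = setT `&` (fun z : Rm => Num.sqrt (sqnorm z)) @^-1`
      `]-oo, eta2 beta m]%classic).
    exact: (@measurable_norm R m measurableT _ (measurable_itv `]-oo, eta2 beta m])).
  by rewrite setTI; apply/seteqP; split => z; rewrite /A/= in_itv/=.
have AC : ~` A = [set z : Rm | (r < sqnorm z)%R].
  by apply/seteqP; split => z; rewrite /A/= etaE ler_sqrt// ltNge => /negP.
have NA : N (~` A) <= beta%:E.
  by rewrite AC -xE (le_trans (gauss_chernoff r w0))// lee_fin ler_expR.
have NT : N A + N (~` A) = 1.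
  rewrite -measureU//; [|exact: measurableC|exact: setICr].
  by rewrite setUv; exact: std_gaussian_setT.
rewrite EFinB leeBlDr// -[in leLHS]NT leeD2l//.
Qed.

End chi_tail.

(** * Square roots of positive definite matrices *)

(** Newton's step: the correction is a multiple of the product vanishing at all earlier nodes.
    Repeated nodes are skipped, since a list of eigenvalues may have them. *)
Lemma poly_interpolation (F : fieldType) (xs : seq F) (f : F -> F) :
  exists r : {poly F}, forall x, x \in xs -> r.[x] = f x.
Proof.
elim: xs => [|x xs [r rE]]; first by exists 0.
have [xxs|xxs] := boolP (x \in xs).
  exists r => y; rewrite inE => /predU1P[->|]; exact: rE.
pose q := \prod_(y <- xs) ('X - y%:P).
have qx0 : q.[x] != 0 by rewrite -rootE root_prod_XsubC.
exists (r + ((f x - r.[x]) / q.[x]) *: q) => y.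
rewrite hornerD hornerZ inE => /predU1P[->|yxs].
  by rewrite divfK// addrC subrK.
suff -> : q.[y] = 0 by rewrite mulr0 addr0 rE.
by apply/eqP; rewrite -rootE root_prod_XsubC.
Qed.

Section posdef.
Variable R : realType.

Lemma dot_mx_ge0 n (v : 'cV[R]_n) : 0 <= (v^T *m v) 0 0.
Proof. by rewrite mxE sumr_ge0// => i _; rewrite mxE -expr2 sqr_ge0. Qed.

Lemma dot_mx_eq0 n (v : 'cV[R]_n) : ((v^T *m v) 0 0 == 0) = (v == 0).
Proof.
apply/idP/idP => [|/eqP->]; last by rewrite mulmx0 mxE.
rewrite mxE psumr_eq0 => [/allP v0|i _]; last by rewrite mxE -expr2 sqr_ge0.
apply/eqP/matrixP => i j; rewrite ord1 mxE.
have := v0 i (mem_index_enum _); rewrite mxE -expr2 sqrf_eq0 => /eqP; exact.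
Qed.

Lemma dot_mx_gt0 n (v : 'cV[R]_n) : v != 0 -> 0 < (v^T *m v) 0 0.
Proof. by move=> v0; rewrite lt0r dot_mx_eq0 v0 dot_mx_ge0. Qed.

Lemma posdef_unitmx n (A : 'M[R]_n) : posdef_mx A -> A \in unitmx.
Proof.
move=> [AT Apos]; rewrite -row_free_unit -kermx_eq0; apply/negP => /negP k0.
have /rowV0Pn[v vk v0] := k0.
have vA : v *m A = 0 by apply/sub_kermxP.
have := Apos v^T; rewrite trmxK vA mul0mx mxE ltxx => H.
by have : false by apply: H; rewrite -(inj_eq trmx_inj) trmxK trmx0.
Qed.

Lemma posdef_invmx n (A : 'M[R]_n) : posdef_mx A -> posdef_mx (invmx A).
Proof.
move=> pA; have Au := posdef_unitmx pA; have [AT Apos] := pA.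
split; first by rewrite trmx_inv AT.
move=> v v0; set w := invmx A *m v.
have vE : v = A *m w by rewrite mulKVmx.
rewrite -mulmxA -/w vE trmx_mul AT; apply: Apos.
by apply: contraNneq v0 => w0; rewrite vE w0 mulmx0.
Qed.

Lemma posdef_sqr n (T : 'M[R]_n) : T^T = T -> T \in unitmx -> posdef_mx (T *m T).
Proof.
move=> TT Tu; split; first by rewrite trmx_mul TT.
move=> v v0; rewrite mulmxA -mulmxA -{1}TT -trmx_mul; apply: dot_mx_gt0.
by apply: contraNneq v0 => Tv0; rewrite -(mulKmx Tu v) Tv0 mulmx0.
Qed.

Lemma tr_horner_mx n (A : 'M[R]_n.+1) (p : {poly R}) : A^T = A ->
  (horner_mx A p)^T = horner_mx A p.
Proof.
move=> AT; elim/poly_ind: p => [|p c IH]; first by rewrite rmorph0 trmx0.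
rewrite rmorphD rmorphM/= horner_mx_X horner_mx_C linearD/= tr_scalar_mx.
rewrite -mulmxE trmx_mul AT IH; congr (_ + _).
exact: comm_mx_horner.
Qed.

(* A real symmetric matrix is diagonalizable over R[i] with real eigenvalues,
   so a real polynomial vanishing at its real eigenvalues kills it. *)
Lemma horner_mx_sym_eq0 n (A : 'M[R]_n.+1) : A^T = A ->
  exists2 xs : seq R, all (eigenvalue A) xs &
    forall p : {poly R}, all (root p) xs -> horner_mx A p = 0.
Proof.
move=> AT; pose toC := real_complex R.
pose B : 'M[R[i]]_n.+1 := map_mx toC A.
have Bsym : B \is hermsymmx.
  apply/is_hermitianmxP/matrixP => i j; rewrite expr0 scale1r !mxE -{1}AT mxE.
  by apply/eqP; rewrite eq_complex /= oppr0 !eqxx.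
have /orthomx_spectralP := hermitian_normalmx Bsym.
set P := spectralmx B; set D := spectral_diag B => BE.
have Pu : P \in unitmx := spectral_unit B.
have Dreal i : toC (complex.Re (D 0 i)) = D 0 i.
  by apply: RRe_real; have /mxOverP/(_ 0 i) := hermitian_spectral_diag_real Bsym.
exists [seq complex.Re (D 0 i) | i <- enum 'I_n.+1].
  apply/allP => _ /mapP[i _ ->].
  (* The characteristic polynomial commutes with the embedding of [R], so a real eigenvalue over
     [R[i]] is one over [R]; a row of the diagonalizing matrix is the eigenvector. *)
  rewrite eigenvalue_root_char -(fmorph_root toC) map_char_poly [X in root _ X](Dreal i).
  rewrite -eigenvalue_root_char; apply/eigenvalueP; exists (row i P).
    change (row i P *m B = D 0 i *: row i P).
    rewrite {1}BE !mulmxA -row_mul mulmxV// row1 -rowE row_diag_mx.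
    by rewrite -scalemxAl -rowE.
  apply/negP => /eqP Pi0.
  have := row_mul i P (invmx P); rewrite mulmxV// Pi0 mul0mx row1 => /matrixP/(_ 0 i).
  by rewrite !mxE !eqxx => /eqP; rewrite oner_eq0.
move=> p /allP p0; apply: (map_mx_inj (f := toC)).
rewrite map_horner_mx -/B map_mx0 BE horner_mx_uconjC// horner_mx_diag.
suff -> : map_mx (horner (map_poly toC p)) D = 0.
  by rewrite raddf0 mulmx0 mul0mx.
apply/matrixP => i j; rewrite ord1 !mxE -Dreal horner_map.
by have /p0/rootP -> := map_f (fun i => complex.Re (D 0 i)) (mem_enum 'I_n.+1 j); rewrite ?rmorph0.
Qed.

Lemma posdef_eigenvalue_gt0 n (A : 'M[R]_n) x :
  posdef_mx A -> eigenvalue A x -> 0 < x.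
Proof.
move=> [AT Apos] /eigenvalueP[v vA v0].
have vT0 : v^T != 0 by rewrite -(inj_eq trmx_inj) trmxK trmx0.
have := Apos _ vT0; rewrite trmxK vA -scalemxAl mxE.
by rewrite pmulr_lgt0//; have := dot_mx_gt0 vT0; rewrite trmxK.
Qed.

(* For r interpolating the fourth root at the eigenvalues of A, the matrix
   r(A)^2 is a square root of A, and it is positive definite as a square. *)
Lemma posdef_sqrt_ex n (A : 'M[R]_n) : posdef_mx A ->
  exists S : 'M[R]_n, posdef_mx S /\ S *m S = A.
Proof.
case: n A => [|n] A pA.
  (* [horner_mx] is used in size n.+1; the empty matrix is its own root. *)
  by exists A; split => //; apply/matrixP => -[].
have [AT _] := pA; have [xs xsA xs0] := horner_mx_sym_eq0 AT.
have [r rE] := poly_interpolation xs (fun x => Num.sqrt (Num.sqrt x)).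
have r4 : horner_mx A r ^+ 4 = A.
  rewrite -[RHS]horner_mx_X -rmorphXn/=; apply/eqP; rewrite -subr_eq0 -rmorphB/=.
  apply/eqP/xs0/allP => x xxs; rewrite rootE !hornerE rE// (exprM _ 2 2).
  by rewrite !sqr_sqrtr ?sqrtr_ge0// ?subrr// ltW//
    (posdef_eigenvalue_gt0 pA)// (allP xsA).
have TT := tr_horner_mx r AT.
have Tu : horner_mx A r \in unitmx.
  have := posdef_unitmx pA; rewrite -{1}r4 exprS -mulmxE unitmx_mul.
  by case/andP.
exists (horner_mx A r *m horner_mx A r); split; first exact: posdef_sqr.
by rewrite -[RHS]r4 !mulmxE -!expr2 -exprM.
Qed.

Lemma sqrt_mxP n (A : 'M[R]_n) : posdef_mx A ->
  posdef_mx (sqrt_mx A) /\ sqrt_mx A *m sqrt_mx A = A.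
Proof.
move=> pA; rewrite /sqrt_mx; case: xgetP => [S _ //|noS].
by have [S SP] := posdef_sqrt_ex pA; case: (noS S).
Qed.

End posdef.

(** * The Gram matrix *)

Section quadratic_form.
Variable R : realType.

Definition qform n (A : 'M[R]_n) (v : 'cV[R]_n) : R := (v^T *m A *m v) 0 0.

Definition colv m (a : m.-tuple (measurableTypeR R)) : 'cV[R]_m :=
  \col_i (tnth a i : R).

Lemma qformE n (A : 'M[R]_n) v :
  qform A v = \sum_i \sum_j v i 0 * v j 0 * A i j.
Proof.
rewrite /qform mxE exchange_big/=; apply: eq_bigr => j _.
rewrite mxE mulr_suml; apply: eq_bigr => i _.
by rewrite mxE mulrAC.
Qed.

Lemma qform_ge0 n (A : 'M[R]_n) v : posdef_mx A -> 0 <= qform A v.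
Proof.
move=> [_ pA]; have [->|v0] := eqVneq v 0; last exact/ltW/pA.
by rewrite /qform mulmx0 mxE.
Qed.

Lemma qform_eq0 n (A : 'M[R]_n) v : posdef_mx A -> (qform A v == 0) = (v == 0).
Proof.
move=> [_ pA]; have [->|v0] := eqVneq v 0; first by rewrite /qform mulmx0 mxE eqxx.
by apply/negbTE; rewrite gt_eqF//; exact: pA.
Qed.

Lemma qformN n (A : 'M[R]_n) v : qform A (- v) = qform A v.
Proof. by rewrite /qform [(- v)^T]linearN /= mulmxN !mulNmx opprK. Qed.

Lemma qform_sqrt n (A T : 'M[R]_n) v : T^T = T -> T *m T = A ->
  qform A v = \sum_i (T *m v) i 0 ^+ 2.
Proof.
move=> TT <-; rewrite /qform mulmxA -mulmxA -{1}TT -trmx_mul mxE.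
by apply: eq_bigr => i _; rewrite mxE expr2.
Qed.

Lemma qform_triangle n (A : 'M[R]_n) v w : posdef_mx A ->
  Num.sqrt (qform A (v + w)) <= Num.sqrt (qform A v) + Num.sqrt (qform A w).
Proof.
move=> pA; have q0 u : 0 <= qform A u by exact: qform_ge0.
set p := Num.sqrt (qform A v); set q := Num.sqrt (qform A w).
have p0 : 0 <= p by exact: sqrtr_ge0.
have q0' : 0 <= q by exact: sqrtr_ge0.
have pE : qform A v = p ^+ 2 by rewrite sqr_sqrtr.
have qE : qform A w = q ^+ 2 by rewrite sqr_sqrtr.
pose b : R := (v^T *m A *m w) 0 0.
have bE : (w^T *m A *m v) 0 0 = b.
  rewrite /b -[w^T *m A *m v]trmxK [in LHS]mxE !trmx_mul trmxK.
  by have [-> _] := pA; rewrite mulmxA.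
have addE (M P : 'M[R]_1) : (M + P) 0 0 = M 0 0 + P 0 0 by rewrite mxE.
have sclE (k : R) (M : 'M[R]_1) : (k *: M) 0 0 = k * M 0 0 by rewrite mxE.
have expand (s t : R) : qform A (s *: v + t *: w) =
    s ^+ 2 * p ^+ 2 + 2 * (s * t) * b + t ^+ 2 * q ^+ 2.
  have tD : (s *: v + t *: w)^T = s *: v^T + t *: w^T.
    by apply/matrixP => i j; rewrite !mxE.
  rewrite -pE -qE /qform tD !(mulmxDl, mulmxDr).
  rewrite -?scalemxAl -?scalemxAr -?scalemxAl.
  by rewrite 3!addE !sclE bE -/b; ring.
have bpq : b <= p * q.
  have [v0|v0] := eqVneq v 0; first by rewrite /b v0 trmx0 !mul0mx mxE mulr_ge0.
  have [w0|w0] := eqVneq w 0; first by rewrite /b w0 mulmx0 mxE mulr_ge0.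
  have pp : 0 < p by rewrite sqrtr_gt0 lt0r q0 qform_eq0// v0.
  have qp : 0 < q by rewrite sqrtr_gt0 lt0r q0 qform_eq0// w0.
  (* The form at q v - p w equals 2 p q (p q - b); its sign gives Cauchy-Schwarz. *)
  have := q0 (q *: v + (- p) *: w); rewrite expand => h.
  by rewrite -subr_ge0 -(pmulr_rge0 _ (mulr_gt0 pp qp)); nra.
rewrite -[leRHS]ger0_norm ?addr_ge0// -sqrtr_sqr ler_sqrt ?sqr_ge0//.
have := expand 1 1; rewrite !scale1r => ->.
by rewrite !expr1n !mul1r mulr1 sqrrD; nra.
Qed.

End quadratic_form.

Lemma measurable_box d (T : measurableType d) n (I_ : 'I_n -> set T) :
  (forall i, measurable (I_ i)) -> measurable (box I_).
Proof.
move=> mI; rewrite (_ : box I_ = \bigcap_(i in [set: 'I_n]) ((@tnth _ T ^~ i) @^-1` I_ i)).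
  apply: fin_bigcap_measurable; first exact: finite_finset.
  move=> i _; rewrite -[X in measurable X]setTI.
  exact: (@measurable_tnth _ T n i measurableT _ (mI i)).
by apply/seteqP; split => [t It i _|t It i]; exact: It.
Qed.

Section gram.
Context d (T : measurableType d) (R : realType).
Variables (mu : {measure set T -> \bar R}) (I : set T) (mI : measurable I).
Variables (m : nat) (phi : 'I_m -> T -> R).
Hypothesis phi_L2 : forall j, square_integrable mu I (phi j).

Let G := gram_mx mu I phi.

(** Dominated by the sum of the two squares, since |x y| <= x^2 + y^2; linearity of the real-valued
    integral rests on it. *)
Let integrable_mul j l : mu.-integrable I (EFin \o (fun t => phi j t * phi l t)).
Proof.
have isq k : mu.-integrable I (EFin \o (fun t => phi k t ^+ 2)).
  have [mk kfin] := phi_L2 k; apply/integrableP; split.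
    by apply/measurable_EFinP; exact: measurable_funX.
  under eq_integral do rewrite /= ger0_norm ?sqr_ge0//.
  exact: kfin.
apply: (le_integrable mI _ _ (integrableD mI (isq j) (isq l))).
  by apply/measurable_EFinP; apply: measurable_funM; [have [] := phi_L2 j|have [] := phi_L2 l].
move=> t _; rewrite /= lee_fin [leRHS]ger0_norm ?addr_ge0 ?sqr_ge0// normrM.
rewrite -(real_normK (num_real (phi j t))) -(real_normK (num_real (phi l t))).
by have := sqr_ge0 (`|phi j t| - `|phi l t|); nra.
Qed.

Let Rintegral_sum n (f : 'I_n -> T -> R) :
  (forall i, mu.-integrable I (EFin \o f i)) ->
  \int[mu]_(t in I) \sum_i f i t = \sum_i \int[mu]_(t in I) f i t.
Proof.
move=> intf; rewrite /Rintegral.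
under eq_integral do rewrite -sumEFin.
rewrite (integral_sum mI intf) -sum_fine//.
by move=> i _; exact: integrable_fin_num.
Qed.

Let linsum (v : 'cV[R]_m) t := \sum_j v j 0 * phi j t.

Let linsum_sqr v t : linsum v t ^+ 2 =
  \sum_i \sum_j v i 0 * v j 0 * (phi i t * phi j t).
Proof.
rewrite expr2 /linsum mulr_suml; apply: eq_bigr => i _.
by rewrite mulr_sumr; apply: eq_bigr => j _; rewrite mulrACA.
Qed.

Let integrable_linsum_row (v : 'cV[R]_m) i :
  mu.-integrable I (EFin \o (fun t => \sum_j v i 0 * v j 0 * (phi i t * phi j t))).
Proof.
apply: (eq_integrable mI (fun t => \sum_j (v i 0 * v j 0)%:E * (phi i t * phi j t)%:E)%E).
  by move=> t _; rewrite /= -sumEFin; apply: eq_bigr => j _; rewrite EFinM.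
apply: integrable_sum => // j _.
exact: (integrableZl mI _ (integrable_mul i j)).
Qed.

Let integrable_linsum_sqr v : mu.-integrable I (EFin \o (fun t => linsum v t ^+ 2)).
Proof.
apply: (eq_integrable mI (fun t =>
  \sum_i (\sum_j v i 0 * v j 0 * (phi i t * phi j t))%:E)%E).
  by move=> t _; rewrite /= linsum_sqr sumEFin.
by apply: integrable_sum => // i _; exact: integrable_linsum_row.
Qed.

Lemma Rintegral_linsum_sqr v : \int[mu]_(t in I) (linsum v t ^+ 2) = qform G v.
Proof.
rewrite qformE; under eq_Rintegral do rewrite linsum_sqr.
rewrite Rintegral_sum => [|i]; last exact: integrable_linsum_row.
apply: eq_bigr => i _; rewrite Rintegral_sum => [|j]; last first.
  exact: (integrableZl mI _ (integrable_mul i j)).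
by apply: eq_bigr => j _; rewrite RintegralZl// mxE.
Qed.

Lemma dist2_lincomb (a b : m.-tuple (measurableTypeR R)) :
  dist2 mu I (lincomb phi a) (lincomb phi b) = Num.sqrt (qform G (colv a - colv b)).
Proof.
rewrite /dist2 -Rintegral_linsum_sqr; congr Num.sqrt; apply: eq_Rintegral => t _.
congr (_ ^+ 2); rewrite /lincomb /linsum -sumrB; apply: eq_bigr => j _.
by rewrite !mxE mulrBl.
Qed.

(** If the form is not positive at [v], the squared combination has integral 0, so the combination
    vanishes almost everywhere on [I] and independence gives v = 0. *)
Lemma posdef_gram : lin_indep mu I phi -> posdef_mx G.
Proof.
move=> free; split.
  by apply/matrixP => i j; rewrite !mxE; apply: eq_Rintegral => t _; rewrite mulrC.
move=> v; apply: contraNT; rewrite -leNgt => v0.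
have F0 : \int[mu]_(t in I) (linsum v t ^+ 2) = 0.
  apply/eqP; rewrite eq_le Rintegral_ge0 ?andbT => [|t _]; last exact: sqr_ge0.
  by rewrite Rintegral_linsum_sqr.
have : (\int[mu]_(t in I) `|(linsum v t ^+ 2)%:E| = 0)%E.
  under eq_integral do rewrite gee0_abs ?lee_fin ?sqr_ge0//.
  by rewrite -[LHS]fineK ?[fine _]F0//; exact: (integrable_fin_num mI (integrable_linsum_sqr v)).
move=> /(ae_eq_integral_abs mu mI (measurable_int _ (integrable_linsum_sqr v))) ae0.
pose a : m.-tuple (measurableTypeR R) := [tuple (v i 0 : measurableTypeR R) | i < m].
have /free a0 : {ae mu, forall t, I t -> lincomb phi a t = 0}.
  move: ae0; apply: filterS => t /= h /h -[/eqP].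
  rewrite sqrf_eq0 => /eqP <-; rewrite /lincomb /linsum; apply: eq_bigr => j _.
  by rewrite tnth_mktuple.
apply/eqP/matrixP => i j; rewrite ord1 mxE.
by have := a0 i; rewrite tnth_mktuple.
Qed.

End gram.

(** * The mechanism *)

Section perturb.
Variables (R : realType) (m : nat).
Local Notation Rm := (m.-tuple (measurableTypeR R)).
Implicit Types (a b z : Rm) (S : 'M[R]_m).

Lemma colv_inj : injective (@colv R m).
Proof.
move=> a b /matrixP ab; apply: eq_from_tnth => i.
by have := ab i 0; rewrite !mxE.
Qed.

Definition tuple_of_colv (v : 'cV[R]_m) : Rm :=
  [tuple (v i 0 : measurableTypeR R) | i < m].

Lemma tuple_of_colvK : cancel tuple_of_colv (@colv R m).
Proof. by move=> v; apply/matrixP => i j; rewrite ord1 mxE tnth_mktuple. Qed.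

Lemma colv_perturb (rho : R) S a z :
  colv (perturb rho S a z) = colv a + (Num.sqrt (2 * rho))^-1 *: (S *m colv z).
Proof. by apply/matrixP => i j; rewrite ord1 !mxE tnth_mktuple mxE. Qed.

Lemma colv_affine1 b z : colv (affine_tuple 1 b z) = colv z + colv b.
Proof. by apply/matrixP => i j; rewrite ord1 !mxE tnth_mktuple mul1r. Qed.

Lemma sqnormE z : sqnorm z = \sum_i (colv z i 0) ^+ 2.
Proof. by apply: eq_bigr => i _; rewrite mxE. Qed.

End perturb.

Section gauss_mechanism.
Variables (R : realType) (m : nat) (rho : R) (G T : 'M[R]_m).
Hypotheses (rho_gt0 : 0 < rho) (Gu : G \in unitmx).
Hypotheses (TT : T^T = T) (TTG : T *m T = invmx G).
Local Notation Rm := (m.-tuple (measurableTypeR R)).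
Local Notation leb := (borel_measure_Rm R m).
Local Notation N := (std_gaussian R m).
Local Notation c := (Num.sqrt (2 * rho))^-1.

Let Tu : T \in unitmx.
Proof.
have : T *m T \in unitmx by rewrite TTG unitmx_inv.
by rewrite unitmx_mul => /andP[].
Qed.

Let c_gt0 : 0 < c.
Proof. by rewrite invr_gt0 sqrtr_gt0 mulr_gt0. Qed.

Let c_unit : c != 0. Proof. by rewrite gt_eqF. Qed.

Let invT_sym : (invmx T)^T = invmx T.
Proof. by rewrite trmx_inv TT. Qed.

Let invTT : invmx T *m invmx T = G.
Proof.
have TTu : T *m T \in unitmx by rewrite unitmx_mul Tu.
have TTV : T *m T *m (invmx T *m invmx T) = 1%:M.
  by rewrite mulmxA -(mulmxA T T) mulmxV// mulmx1 mulmxV.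
by rewrite -[RHS]invmxK -TTG -[LHS](mulKmx TTu) TTV mulmx1.
Qed.

(** As G = T^-1 T^-1, the form undoes [T] and leaves the Euclidean norm of [z] scaled by [c]. *)
Lemma norm_perturb a z :
  Num.sqrt (qform G (colv (perturb rho T a z) - colv a)) =
  Num.sqrt (sqnorm z) / Num.sqrt (2 * rho).
Proof.
rewrite colv_perturb addrC addKr (qform_sqrt _ invT_sym invTT).
rewrite -[in RHS](ger0_norm (ltW c_gt0)) -sqrtr_sqr -sqrtrM ?sqnorm_ge0//.
congr Num.sqrt; rewrite sqnormE mulr_suml; apply: eq_bigr => i _.
by rewrite -scalemxAr mulKmx// mxE exprMn mulrC.
Qed.

(** The difference of the centres, pulled back through the linear part c T, becomes a shift of the
    Gaussian. *)
Lemma perturb_shift a a' z :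
  perturb rho T a z = perturb rho T a' (affine_tuple 1
    (tuple_of_colv (c^-1 *: (invmx T *m (colv a - colv a')))) z).
Proof.
apply: colv_inj; rewrite !colv_perturb colv_affine1 tuple_of_colvK mulmxDr.
rewrite -scalemxAr mulKVmx// scalerDr scalerA mulfV// scale1r.
by rewrite [X in _ = _ + X]addrC [RHS]addrA subrKC.
Qed.

Lemma perturb_equivariant a z y :
  affine_tuple 1 y (perturb rho T a z) =
  perturb rho T a (affine_tuple 1 (tuple_of_colv (c^-1 *: (invmx T *m colv y))) z).
Proof.
apply: colv_inj; rewrite colv_affine1 !colv_perturb colv_affine1 tuple_of_colvK.
by rewrite mulmxDr -scalemxAr mulKVmx// scalerDr scalerA mulfV// scale1r addrA.
Qed.

(* The inverse is written as a perturbation so that measurable_perturb applies. *)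
Lemma perturbK a : cancel (perturb rho T a) (perturb rho ((2 * rho) *: invmx T)
  (tuple_of_colv (- (c^-1 *: (invmx T *m colv a))))).
Proof.
move=> z; apply: colv_inj; rewrite !colv_perturb tuple_of_colvK.
(* [perturb] multiplies its matrix by [c]; the factor 2 rho = c^-2 turns this into c^-1. *)
have cE : c * (2 * rho) = c^-1.
  have : 2 * rho = Num.sqrt (2 * rho) ^+ 2 by rewrite sqr_sqrtr// mulr_ge0// ltW.
  move: c_unit; set s := Num.sqrt _ => s0 ->.
  by rewrite invrK expr2 mulKf// -invr_eq0.
rewrite -scalemxAl scalerA cE mulmxDr -scalemxAr mulKmx// scalerDr scalerA.
by rewrite mulVf// scale1r addKr.
Qed.

Lemma sqnorm_shift a a' :
  sqnorm (tuple_of_colv (c^-1 *: (invmx T *m (colv a - colv a')))) =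
  2 * rho * qform G (colv a - colv a').
Proof.
rewrite sqnormE tuple_of_colvK (qform_sqrt _ invT_sym invTT) mulr_sumr.
by apply: eq_bigr => i _; rewrite mxE exprMn invrK sqr_sqrtr// mulr_ge0// ltW.
Qed.

Context (disp : measure_display) (Omega : measurableType disp).
Variables (P : probability Omega R) (Z : {RV P >-> m.-tuple (measurableTypeR R)}).
Hypothesis Z_gauss : forall A, measurable A -> distribution P Z A = N A.

Lemma distribution_perturb a A : measurable A ->
  distribution P (perturb rho T a \o Z) A = N (perturb rho T a @^-1` A).
Proof.
move=> mA; rewrite -Z_gauss//.
by rewrite -[X in measurable X]setTI; exact: measurable_perturb.
Qed.

Lemma cgp_perturb :
  cgp leb (fun a a' : Rm => Num.sqrt (qform G (colv a - colv a'))) rho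
    (fun a => distribution P (perturb rho T a \o Z)).
Proof.
split=> [a|a a' alpha p q alpha1 Pp Qq].
  apply: (@density_ex _ _ _ (distribution P (perturb rho T a \o Z)) leb) => A mA A0.
  rewrite /= distribution_perturb// std_gaussian_null//.
    by rewrite -[X in measurable X]setTI; exact: measurable_perturb.
  apply: (null_preimage_equivariant _ (perturb_equivariant a)) => //.
rewrite (gauss_renyi_div (measurable_perturb rho T a') (measurable_perturb _ _ _)
  (perturbK a') (perturb_shift a a') (distribution_perturb a)
  (distribution_perturb a') alpha1 Pp Qq).
rewrite sqnorm_shift sqr_sqrtr; last first.
  by rewrite (qform_sqrt _ invT_sym invTT) sumr_ge0// => i _; rewrite sqr_ge0.
(* The bound is attained: alpha |b|^2 / 2 equals alpha rho dist^2. *)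
by rewrite lee_fin le_eqVlt; apply/orP; left; apply/eqP; field.
Qed.

End gauss_mechanism.

Theorem lemma3p5 (R : realType) (d m : nat) (hd : (0 < d)%N) (hm : (0 < m)%N)
    (I_ : 'I_d -> set (lebesgueTypeR R)) (mI : forall i, measurable (I_ i))
    (rho : R) (rho_gt0 : 0 < rho)
    (phi : 'I_m -> d.-tuple (lebesgueTypeR R) -> R)
    (phi_L2 : forall j,
      square_integrable (lebesgue_measure_Rd R d) (box I_) (phi j))
    (phi_free : lin_indep (lebesgue_measure_Rd R d) (box I_) phi)
    (disp : measure_display) (Omega : measurableType disp)
    (P : probability Omega R) (Z : {RV P >-> m.-tuple (measurableTypeR R)})
    (Z_gauss : forall A, measurable A ->
      distribution P Z A = std_gaussian R m A) :
  let dist (a a' : m.-tuple (measurableTypeR R)) : R :=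
    dist2 (lebesgue_measure_Rd R d) (box I_) (lincomb phi a) (lincomb phi a') in
  let Sigma : 'M[R]_m :=
    invmx (gram_mx (lebesgue_measure_Rd R d) (box I_) phi) in
  let M (a : m.-tuple (measurableTypeR R)) :
      {RV P >-> m.-tuple (measurableTypeR R)} :=
    perturb rho (sqrt_mx Sigma) a \o Z in
  [/\ is_metric dist,
      cgp (borel_measure_Rm R m) dist rho (fun a => distribution P (M a)),
      (forall a : m.-tuple (measurableTypeR R),
        'E_P[fun w => dist (M a w) a]%E =
          (Num.sqrt 2 * (Gamma (m%:R / 2 + 2^-1)
             / (Gamma (m%:R / 2) * Num.sqrt (2 * rho))))%:E /\
        Num.sqrt 2 * (Gamma (m%:R / 2 + 2^-1)
             / (Gamma (m%:R / 2) * Num.sqrt (2 * rho)))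
          <= Num.sqrt m%:R / Num.sqrt (2 * rho)) &
      (forall (a : m.-tuple (measurableTypeR R)) (beta : R), 0 < beta < 1 ->
        ((1 - beta)%:E <=
           P [set w | (dist (M a w) a <= eta2 beta m / Num.sqrt (2 * rho))%R])%E)].
Proof.
move=> dist Sigma M.
pose mu := lebesgue_measure_Rd R d.
have mI' : measurable (box I_) by exact: measurable_box.
pose G := gram_mx mu (box I_) phi.
have pG : posdef_mx G by exact: posdef_gram.
have Gu := posdef_unitmx pG.
have [[TT _] TTS] := sqrt_mxP (posdef_invmx pG).
have distE a b : dist a b = Num.sqrt (qform G (colv a - colv b)).
  exact: dist2_lincomb.
have distM a w : dist (M a w) a = Num.sqrt (sqnorm (Z w)) / Num.sqrt (2 * rho).
  by rewrite distE (norm_perturb rho_gt0 Gu TT TTS).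
have rho2 : 0 < Num.sqrt (2 * rho) by rewrite sqrtr_gt0 mulr_gt0.
have mn := @measurable_norm R m.
have chiE : (\int[std_gaussian R m]_z (Num.sqrt (sqnorm z) / Num.sqrt (2 * rho))%:E =
    (Num.sqrt 2 * (Gamma (m%:R / 2 + 2^-1)
       / (Gamma (m%:R / 2) * Num.sqrt (2 * rho))))%:E)%E.
  under eq_integral do rewrite EFinM.
  rewrite ge0_integralZr//; last exact/measurable_EFinP.
  by rewrite gauss_norm_expectation// -EFinM invfM !mulrA.
split.
- split.
  + by move=> a b; rewrite distE sqrtr_ge0.
  (* Positive definiteness, hence the independence of the [phi], separates coefficient vectors. *)
  + move=> a b; rewrite distE; split => [/eqP|->]; last first.
      by rewrite subrr /qform mulmx0 mxE sqrtr0.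
    rewrite sqrtr_eq0 => q0; apply: colv_inj; apply/eqP; rewrite -subr_eq0.
    by rewrite -(qform_eq0 _ pG) eq_le q0 qform_ge0.
  + by move=> a b; rewrite !distE -qformN opprB.
  + move=> a b e; rewrite !distE (_ : colv a - colv e = (colv a - colv b) +
      (colv b - colv e)); first exact: qform_triangle.
    by rewrite addrA subrK.
- have := cgp_perturb rho_gt0 Gu TT TTS Z_gauss.
  by rewrite (_ : dist = fun a a' => Num.sqrt (qform G (colv a - colv a')))//;
    apply/funext => a; apply/funext => b.
- move=> a; split.
    rewrite unlock.
    transitivity (\int[distribution P Z]_z
        (Num.sqrt (sqnorm z) / Num.sqrt (2 * rho))%:E)%E.
      rewrite ge0_integral_distribution//.
      + by apply: eq_integral => w _; rewrite distM.
      + by apply/measurable_EFinP; exact: measurable_funM.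
    rewrite -chiE; apply: eq_measure_integral => A mA _; exact: Z_gauss.
  (* The Gamma quotient is turned back into the mean that it equals, which [gauss_norm_le]
     bounds. *)
  rewrite -lee_fin -chiE.
  under eq_integral do rewrite EFinM.
  rewrite ge0_integralZr//; last exact/measurable_EFinP.
  by rewrite [leRHS]EFinM lee_wpmul2r ?lee_fin ?invr_ge0 ?(ltW rho2)// gauss_norm_le.
- move=> a beta b01.
  rewrite (_ : [set w | _] =
      Z @^-1` [set z | Num.sqrt (sqnorm z) <= eta2 beta m]); last first.
    by apply/seteqP; split => w /=; rewrite distM ler_pM2r ?invr_gt0.
  rewrite [leRHS](_ : _ = std_gaussian R m
      [set z | Num.sqrt (sqnorm z) <= eta2 beta m]); first exact: gauss_norm_tail.
  apply: Z_gauss.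
  rewrite (_ : [set z | _] = setT `&` (fun z => Num.sqrt (sqnorm z)) @^-1`
      `]-oo, eta2 beta m]%classic).
    exact: (mn measurableT _ (measurable_itv `]-oo, eta2 beta m])).
  by rewrite setTI; apply/seteqP; split => z; rewrite /= in_itv/=.
Qed.
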